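(* For every complex number $q$ with $|q|<1$, the following four identities hold: \begin{align*} \sum_{i,j,k\ge 0}\frac{q^{i^2+2j^2+k^2+2ij+ik}}{(q;q)_i(q^2;q^2)_j(q^2;q^2)_k}&=\frac{(q^{20},q^{24},q^{44};q^{44})_\infty}{(q,q^3,q^4;q^4)_\infty}+q\frac{(-q,q^{10},-q^{11};-q^{11})_\infty}{(q^2,q^2,q^4;q^4)_\infty},\\ \sum_{i,j,k\ge 0}\frac{q^{i^2+2j^2+k^2+2ij+ik+k}}{(q;q)_i(q^2;q^2)_j(q^2;q^2)_k}&=\frac{(-q^5,q^6,-q^{11};-q^{11})_\infty}{(q^2,q^2,q^4;q^4)_\infty}+q\frac{(q^{12},q^{32},q^{44};q^{44})_\infty}{(q,q^3,q^4;q^4)_\infty},\\ \sum_{i,j,k\ge 0}\frac{q^{i^2+2j^2+k^2+2ij+ik+i+k}}{(q;q)_i(q^2;q^2)_j(q^2;q^2)_k}&=\frac{(q^4,-q^7,-q^{11};-q^{11})_\infty}{(q^2,q^2,q^4;q^4)_\infty}+q^2\frac{(q^8,q^{36},q^{44};q^{44})_\infty}{(q,q^3,q^4;q^4)_\infty},\\ \sum_{i,j,k\ge 0}\frac{q^{i^2+2j^2+k^2+2ij+ik+2i+2j+k}}{(q;q)_i(q^2;q^2)_j(q^2;q^2)_k}&=\frac{(q^2,-q^9,-q^{11};-q^{11})_\infty}{(q^2,q^2,q^4;q^4)_\infty}+q^3\frac{(q^4,q^{40},q^{44};q^{44})_\infty}{(q,q^3,q^4;q^4)_\infty}. \end{a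lign*}
   Context: Notation: for $n\in\mathbb{Z}_{\ge 0}$, $(a;p)_n=\prod_{k=0}^{n-1}(1-ap^k)$; for $|p|<1$, $(a;p)_\infty=\prod_{k=0}^\infty(1-ap^k)$; and $(a_1,\dots,a_m;p)_n=(a_1;p)_n\cdots(a_m;p)_n$ for $n\in\mathbb{Z}_{\ge0}\cup\{\infty\}$ (the base $p$ may be negative, e.g. $p=-q^{11}$). Sums are over nonnegative integers. *)

(* Defs.v *)
From HB Require Import structures.
From mathcomp Require Import all_boot all_order all_algebra.
From mathcomp Require Import finmap complex.
From mathcomp Require Import all_classical all_reals all_analysis.
From mathcomp.analysis Require summability.

Set Implicit Arguments.
Unset Strict Implicit.
Unset Printing Implicit Defensive.

Import Order.TTheory GRing.Theory Num.Theory.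
Import numFieldNormedType.Exports.

Local Open Scope ring_scope.
Local Open Scope classical_set_scope.

(* (a; p)_n *)
Definition qpoch (K : numFieldType) (a p : K) (n : nat) : K :=
  \prod_(0 <= k < n) (1 - a * p ^+ k).

(* (a; p)_oo. The limit is taken for the norm of K; for K = R[i] it exists
   whenever `|p| < 1, otherwise the value of lim is unspecified. *)
Definition qpoch_inf (K : numFieldType) (a p : K) : K := limn (qpoch a p).

(* (a_1, ..., a_m; p)_oo *)
Definition qpochs_inf (K : numFieldType) (s : seq K) (p : K) : K :=
  \prod_(a <- s) qpoch_inf a p.

(* The family x converges unconditionally to l: the sums over finite sets of
   triples tend to l along the directed set of all such sets. In R[i] this
   amounts to absolute convergence with sum l. *)
Definition has_sum3 (K : numFieldType) (x : nat -> nat -> nat -> K) (l : K) :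
    Prop :=
  summability.partial_sum (fun t : nat * nat * nat => x t.1.1 t.1.2 t.2)
    @ summability.totally --> l.

(* Main.v *)
Require Import Defs.
From mathcomp Require Import all_boot all_order all_algebra.
From mathcomp Require Import finmap complex.
From mathcomp Require Import all_classical all_reals all_analysis.
From mathcomp.analysis Require summability.
From mathcomp Require Import ring lra zify.

(** Write Q = q^2.  Summing over k with the finite form of Euler's identity
    \sum_k q^(k^2 + i k) / (Q;Q)_k = (-q^(i+1);Q)_oo
and splitting i = 2 m + e by parity (e = 0, 1) turns each triple series into
two double series.  With n = m + j the exponent i^2 + 2 i j + 2 j^2 becomes
2 n^2 + 2 m^2 + 2 e (n + m) + e, so that each double series has the shape
    \sum_n Q^(n^2 + a n) \sum_m Q^(m^2 + b m) beta_m / (Q;Q)_(n-m)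
(the linear terms of the exponents only affect a, b and beta), that is, two steps of
  the Bailey chain applied to a sequence beta.  Only four
sequences occur, and they come from two Bailey pairs, written here
bilaterally:
    beta_n = \sum_(r in Z) u(r) / ((Q;Q)_(n-tr) (Q;Q)_(n+b+tr))
with u(r) = zeta^r p^(r(r-1)/2) and (t, p) = (2, q^12) or (1, -q^3).

Both pairs are proved by induction on n: raising b from 0 to 1, and then n by
1 with b going back to 0, changes the sum by a simple factor
(bsumC_step1, bsumC_step2, bsumG_step1, bsumG_step2).  In every case the
discrepancy is a sum over Z of an odd function about an integer or
half-integer, hence 0.  The same oddness shows that the sums for b and b + 1
agree when zeta Q^t = -p (bsum_raise); this is what takes care of the third
identity, where the two steps of the chain have different parameters.

A step of the chain (bailey_chain) is the q-Vandermonde sum; it multiplies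
u(r) by Q^(t^2 r^2 + b t r), which again has the form zeta^r p^(r(r-1)/2).
After two steps p is q^44 or -q^11, and as n tends to infinity the sum becomes
a theta series, evaluated by Jacobi's triple product.  The remaining factors
(-q;Q)_oo / (Q;Q)_oo and (-q^2;Q)_oo / (Q;Q)_oo are the reciprocals of the
denominators of the theorem (product_134, product_224).

All manipulations of sums are made on finite truncations, and a single
dominated convergence principle (tannery_close) passes to the limit, both in
the triple series (triple_has_sum) and in the theta series (theta_limit).
The case q = 0, where negative powers of q make no sense, is checked apart. *)

Set Implicit Arguments.
Unset Strict Implicit.
Unset Printing Implicit Defensive.

Import Order.TTheory GRing.Theory Num.Theory.
Import numFieldNormedType.Exports.

Local Open Scope ring_scope.
Local Open Scope classical_set_scope.

(** * Finite q-shifted factorials *)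

Section QPochhammer.
Context {K : numFieldType}.
Implicit Types (a p : K) (n : nat).

Lemma qpoch0 a p : qpoch a p 0 = 1.
Proof. by rewrite /qpoch big_geq. Qed.

Lemma qpochS a p n : qpoch a p n.+1 = qpoch a p n * (1 - a * p ^+ n).
Proof. by rewrite /qpoch big_nat_recr /=. Qed.

Lemma qpochSl a p n : qpoch a p n.+1 = (1 - a) * qpoch (a * p) p n.
Proof.
elim: n => [|n IH]; first by rewrite qpochS !qpoch0 expr0 mulr1 mulrC.
by rewrite qpochS IH [in RHS]qpochS exprS; ring.
Qed.

Lemma qpochD a p m n :
  qpoch a p (m + n) = qpoch a p m * qpoch (a * p ^+ m) p n.
Proof.
elim: n => [|n IH]; first by rewrite addn0 qpoch0 mulr1.
by rewrite addnS !qpochS IH exprD; ring.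
Qed.

End QPochhammer.

(** * Finitely supported sums over the integers *)

Section IntegerSums.
Context {K : numFieldType}.
Implicit Types (F G : int -> K) (B : nat).

(** The sum of F over the integers of absolute value at most B; for F supported
in that range it stands for the sum over all integers. *)
Definition zsum B F : K := \sum_(i < (2 * B).+1) F (i%:Z - B%:Z).

Definition supported B F := forall s : int, (B < `|s|)%N -> F s = 0.

Lemma zsumS B F : zsum B.+1 F = F (- B.+1%:Z) + zsum B F + F B.+1%:Z.
Proof.
rewrite /zsum mulnS !addSn add0n big_ord_recr big_ord_recl /=.
congr (F _ + _ + F _); [lia | | lia].
by apply: eq_bigr => i _; congr F; rewrite /bump /=; lia.
Qed.

Lemma eq_zsum B F G : F =1 G -> zsum B F = zsum B G.
Proof. by move=> FG; apply: eq_bigr => i _; rewrite FG. Qed.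

Lemma zsum_add B F G : zsum B (fun s => F s + G s) = zsum B F + zsum B G.
Proof. exact: big_split. Qed.

Lemma zsum_scale B (c : K) F : zsum B (fun s => c * F s) = c * zsum B F.
Proof. by rewrite /zsum mulr_sumr. Qed.

Lemma zsum_opp B F : zsum B (fun s => F (- s)) = zsum B F.
Proof.
rewrite /zsum (reindex_inj rev_ord_inj) /=.
by apply: eq_bigr => i _; congr F; have := ltn_ord i; lia.
Qed.

Lemma zsum_widen B B' F : supported B F -> (B <= B')%N ->
  zsum B' F = zsum B F.
Proof.
move=> F0 /subnK <-; elim: (B' - B)%N => // d IH.
by rewrite addSn zsumS IH !F0 ?add0r ?addr0 //; lia.
Qed.

Lemma zsum_shift B F : supported B F ->
  zsum B.+1 (fun s => F (s + 1)) = zsum B.+1 F.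
Proof.
move=> F0; rewrite /zsum; move EM : (2 * B.+1)%N => M.
rewrite big_ord_recr [RHS]big_ord_recl /= F0 ?addr0; last by lia.
rewrite [X in _ = X + _]F0 ?add0r; last by lia.
by apply: eq_bigr => i _; congr F; rewrite /bump /=; lia.
Qed.

Lemma zsum_shift_down B F : supported B F ->
  zsum B.+1 (fun s => F (s - 1)) = zsum B.+1 F.
Proof.
move=> F0; rewrite -[LHS]zsum_opp -[RHS]zsum_opp.
rewrite -[RHS](zsum_shift (F := fun s => F (- s))).
  by apply: eq_zsum => s; rewrite opprD.
by move=> s sB; apply: F0; lia.
Qed.

Lemma opp_eq0 (x : K) : x = - x -> x = 0.
Proof.
move=> xNx; have := mulrn_eq0 x 2.
by rewrite mulr2n [in X in X + _]xNx addNr eqxx => /esym /eqP.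
Qed.

Lemma zsum_odd B F : (forall s, F (- s) = - F s) -> zsum B F = 0.
Proof.
move=> FN; apply: opp_eq0; rewrite -[in LHS]zsum_opp (eq_zsum _ FN).
by rewrite -[RHS]mulN1r -zsum_scale; apply: eq_zsum => s; rewrite mulN1r.
Qed.

(** F is odd about -1/2. *)
Lemma zsum_odd_half B F : supported B F -> (forall s, F (-1 - s) = - F s) ->
  zsum B F = 0.
Proof.
move=> F0 FN; rewrite -(zsum_widen F0 (leqnSn B)).
apply: opp_eq0; rewrite -[in LHS]zsum_opp -(zsum_shift (F := fun s => F (- s))).
  rewrite -[RHS]mulN1r -zsum_scale; apply: eq_zsum => s.
  by rewrite mulN1r -FN; congr F; lia.
by move=> s sB; apply: F0; lia.
Qed.

End IntegerSums.

(** * Theta terms *)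

(** The triangular number s (s - 1) / 2 of an integer s, as a natural number:
for s = - n.+1 it is n.+2 choose 2. *)
Definition tri (s : int) : nat :=
  match s with Posz n => 'C(n, 2) | Negz n => 'C(n.+2, 2) end.

Lemma triE s : (tri s)%:Z *+ 2 = s * (s - 1).
Proof.
have bin2E n : 'C(n.+1, 2)%:Z *+ 2 = n.+1%:Z * n%:Z.
  by have := bin2odd; rewrite -[_ *+ 2]mulr_natr; have := mul_bin_diag n.+1 1;
     rewrite bin1; lia.
case: s => [[|n]|n] /=; [by rewrite bin0n | |].
- by rewrite bin2E -[n.+1%:Z]/(1 + n)%:Z; lia.
- by rewrite bin2E NegzE; lia.
Qed.

Section Weights.
Context {K : numFieldType}.
Implicit Types (z p x : K) (s : int).

(** The general term z^s p^(s(s-1)/2) of a theta series.  The functional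
equations below express its reflections in s, and its products with x^s and
x^(s^2), as theta terms with other parameters. *)
Definition theta_term z p s : K := z ^ s * p ^+ tri s.

Lemma theta_termM z p x s : theta_term z p s * x ^ s = theta_term (z * x) p s.
Proof. by rewrite /theta_term expfzMl; ring. Qed.

Context (z p : K) (z0 : z != 0) (p0 : p != 0).

Lemma theta_term_opp s : theta_term z p (- s) = theta_term (p / z) p s.
Proof.
have E : (tri (- s))%:Z = s + tri s by move: (triE s) (triE (- s)); nia.
rewrite /theta_term !exprnP E expfzDr // expfzMl exprz_inv; ring.
Qed.

Lemma theta_term_half s :
  theta_term z p (-1 - s) = p / z * theta_term (p ^+ 2 / z) p s.
Proof.
have E : (tri (-1 - s))%:Z = 1 + (s + s + tri s).
  by move: (triE s) (triE (-1 - s)); nia.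
rewrite /theta_term expr2 !exprnP E !expfzDr // !expfzMl !exprz_inv.
by rewrite exprN1 expr1z; ring.
Qed.

Lemma theta_term_one s : theta_term z p (1 - s) = z * theta_term z^-1 p s.
Proof.
have E : tri (1 - s) = tri s by move: (triE s) (triE (1 - s)); nia.
by rewrite /theta_term E expfzDr // expr1z exprz_inv; ring.
Qed.

Lemma theta_term_sqr x s : x != 0 ->
  theta_term z p s * x ^ (s * s) = theta_term (z * x) (p * x ^+ 2) s.
Proof.
move=> x0; have E : s * s = s + tri s + tri s by have := triE s; lia.
rewrite /theta_term E !expfzDr // expfzMl exprMn -!exprnP -exprM mulnC exprM; ring.
Qed.

End Weights.

(** * Reciprocal q-factorials and the q-Vandermonde sum *)

Section ReciprocalFactorials.
Context {K : numFieldType} (q : K) (q0 : q != 0).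
Context (q1 : forall n, q ^+ n.+1 != 1).
Implicit Types (k s r : int) (n m b t : nat) (u : int -> K).

(** 1 / (q;q)_k, with the value 0 for k < 0, so that bilateral sums terminate
and iqpoch_pred holds for every integer k. *)
Definition iqpoch k : K := if k is Posz n then (qpoch q q n)^-1 else 0.
Arguments iqpoch : simpl never.

Lemma iqpoch_neg k : k < 0 -> iqpoch k = 0.
Proof. by case: k. Qed.

Lemma iqpoch_pred k : iqpoch k * (1 - q ^ k) = iqpoch (k - 1).
Proof.
case: k => [[|n]|n]; first by rewrite expr0z subrr mulr0.
- rewrite (_ : n.+1%:Z - 1 = n); last by lia.
  rewrite /iqpoch qpochS invfM -exprS mulfVK //.
  by rewrite subr_eq0 eq_sym.
- by rewrite !iqpoch_neg ?mul0r //; lia.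
Qed.

(** The limiting case of the q-Chu-Vandermonde sum that underlies the Bailey
chain.  By induction on n, writing
1 - q^(n+1) = (1 - q^(n+1-m)) + q^(n+1-m) (1 - q^m). *)
Lemma q_vandermonde n b :
  \sum_(m < n.+1) q ^+ (m * m + b * m)
     * (iqpoch (n%:Z - m%:Z) * iqpoch m * iqpoch (m%:Z + b%:Z))
  = iqpoch n * iqpoch (n%:Z + b%:Z).
Proof.
elim: n b => [|n IH] b.
  by rewrite big_ord_recl big_ord0 addr0 !(mul0n,muln0,addn0,expr0) subrr /iqpoch /=
    qpoch0 divr1 mul1r.
have nz : 1 - q ^ n.+1%:Z != 0 by rewrite subr_eq0 eq_sym q1.
apply: (mulIf nz); rewrite mulr_suml.
transitivity (\sum_(m < n.+2) (q ^+ (m * m + b * m)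
     * (iqpoch (n%:Z - m%:Z) * iqpoch m * iqpoch (m%:Z + b%:Z)) +
     q ^ n.+1%:Z * (q ^ (m%:Z * m%:Z + b%:Z * m%:Z - m%:Z)
     * (iqpoch (n.+1%:Z - m%:Z) * iqpoch (m%:Z - 1) * iqpoch (m%:Z + b%:Z))))).
  apply: eq_bigr => m _.
  rewrite -iqpoch_pred (_ : n%:Z - m%:Z = n.+1%:Z - m%:Z - 1); last by lia.
  rewrite -iqpoch_pred exprD !expfzDr // -!invr_expz.
  rewrite -!PoszM -!exprnP; field; exact: expf_neq0.
rewrite big_split /= big_ord_recr /=.
rewrite [X in _ + X + _](_ : _ = 0) ?addr0; last first.
  by rewrite (iqpoch_neg (k := n%:Z - n.+1%:Z)) ?mul0r ?mulr0 //; lia.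
rewrite IH big_ord_recl [X in _ + (X + _)](_ : _ = 0) ?add0r; last first.
  by rewrite (@iqpoch_neg (-1)) // !(mulr0, mul0r).
transitivity (iqpoch n * iqpoch (n%:Z + b%:Z)
    + q ^ (n.+1%:Z + b%:Z) * (iqpoch n * iqpoch (n%:Z + b.+1%:Z))).
  congr (_ + _); rewrite -IH mulr_sumr; apply: eq_bigr => i _.
  rewrite lift0 (_ : n.+1%:Z - i.+1%:Z = n%:Z - i%:Z); last by lia.
  rewrite (_ : i.+1%:Z - 1 = i%:Z); last by lia.
  rewrite (_ : i.+1%:Z + b%:Z = i%:Z + b.+1%:Z); last by lia.
  rewrite !mulrA -expfzDr // exprnP -expfzDr //; congr (q ^ _ * _ * _ * _); lia.
rewrite -[RHS]mulrA [in RHS]mulrCA iqpoch_pred (_ : n.+1%:Z - 1 = n); last by lia.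
rewrite -{1}(_ : n.+1%:Z + b%:Z - 1 = n%:Z + b%:Z); last by lia.
rewrite -iqpoch_pred (_ : n%:Z + b.+1%:Z = n.+1%:Z + b%:Z); last by lia.
ring.
Qed.

(** The previous sum with m replaced by m - s.  Both sides are invariant under
s -> - b - s; for - b < s < 0 the identity fails, as terms with m < 0 would
be needed. *)
Lemma q_vandermonde_shift n b s : (0 <= s) || (s + b%:Z <= 0) ->
  \sum_(m < n.+1) q ^+ (m * m + b * m)
     * (iqpoch (n%:Z - m%:Z) * (iqpoch (m%:Z - s) * iqpoch (m%:Z + b%:Z + s)))
  = q ^ (s * s + b%:Z * s) * (iqpoch (n%:Z - s) * iqpoch (n%:Z + b%:Z + s)).
Proof.
wlog s_ge0 : s / 0 <= s => [hwlog|_].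
  move=> sP; have [s0|s_lt0] := lerP 0 s; first exact: hwlog.
  have := hwlog (- s - b%:Z).
  rewrite (_ : (- s - b%:Z) * (- s - b%:Z) + b%:Z * (- s - b%:Z) =
     s * s + b%:Z * s); last by lia.
  have -> : n%:Z - (- s - b%:Z) = n%:Z + b%:Z + s by lia.
  have -> : n%:Z + b%:Z + (- s - b%:Z) = n%:Z - s by lia.
  rewrite [in X in _ -> X](mulrC (iqpoch (_ - _))) => <-; try by lia.
  apply: eq_bigr => m _; congr (_ * (_ * _)); rewrite mulrC.
  by congr (iqpoch _ * iqpoch _); lia.
case: s s_ge0 => // s _.
have [ns|sn] := ltnP n s.
  rewrite (iqpoch_neg (k := n%:Z - s%:Z)); last by lia.
  rewrite mul0r mulr0 big1 // => m _.
  rewrite (iqpoch_neg (k := m%:Z - s%:Z)); first by rewrite mul0r !mulr0.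
  by have := ltn_ord m; lia.
move EF : (fun m : nat => q ^+ (m * m + b * m)
  * (iqpoch (n%:Z - m%:Z) * (iqpoch (m%:Z - s%:Z) * iqpoch (m%:Z + b%:Z + s%:Z)))) => F.
transitivity (\sum_(0 <= m < n.+1) F m); first by rewrite big_mkord -EF.
rewrite (big_cat_nat (n := s)) //=; last by lia.
rewrite big_nat_cond big1 ?add0r => [|m]; last first.
  rewrite andbT -EF => /= sm.
  by rewrite (iqpoch_neg (k := m%:Z - s%:Z)); [rewrite mul0r !mulr0 | lia].
rewrite -{1}[s]add0n big_addn big_mkord -EF /=.
have -> : n%:Z + b%:Z + s%:Z = (n - s)%N%:Z + (b + s + s)%N%:Z by lia.
have -> : n%:Z - s%:Z = (n - s)%N%:Z by lia.
rewrite -q_vandermonde mulr_sumr subSn //; apply: eq_bigr => m _.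
rewrite [RHS]mulrA -!PoszM -!PoszD -exprnP -exprD; congr (q ^+ _ * _); first by lia.
rewrite -mulrA; congr (iqpoch _ * (iqpoch _ * iqpoch _)); lia.
Qed.

End ReciprocalFactorials.
Arguments iqpoch {K} q k : simpl never.

(** * Bilateral Bailey sums *)

Section BaileySums.
Context {K : numFieldType} (q : K).
Implicit Types (k s r : int) (n m b t B : nat) (u v : int -> K) (z p : K).

Local Notation iq := (iqpoch q).

(** The summand of bsum. *)
Definition bterm t u n b r : K :=
  u r * (iq (n%:Z - t%:Z * r) * iq (n%:Z + b%:Z + t%:Z * r)).

(** The bilateral Bailey sum
  \sum_(r in Z) u(r) / ((q;q)_(n - t r) (q;q)_(n + b + t r)).
For t > 0 its terms vanish for |r| > n + b. *)
Definition bsum t u n b : K := zsum (n + b) (bterm t u n b).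

Lemma bterm_supported t u n b : (0 < t)%N -> supported (n + b) (bterm t u n b).
Proof.
move=> t0 r rB; rewrite /bterm; have [r0|r0] := lerP 0 r.
  by rewrite [iq (n%:Z - _)]iqpoch_neg; [rewrite mul0r mulr0 | nia].
by rewrite [iq (n%:Z + _ + _)]iqpoch_neg; [rewrite !mulr0 | nia].
Qed.

Lemma bsumE B t u n b : (0 < t)%N -> (n + b <= B)%N ->
  bsum t u n b = zsum B (bterm t u n b).
Proof.
by move=> t0 nB; rewrite [RHS](zsum_widen _ nB) //; exact: bterm_supported.
Qed.

Lemma eq_bsum t u v n b : u =1 v -> bsum t u n b = bsum t v n b.
Proof. by move=> uv; apply: eq_zsum => r; rewrite /bterm uv. Qed.

Lemma bsum_opp t u n : bsum t (fun r => u (- r)) n 0 = bsum t u n 0.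
Proof.
rewrite /bsum -[RHS]zsum_opp; apply: eq_zsum => r; rewrite /bterm.
by rewrite addr0 mulrN opprK [X in _ * X]mulrC.
Qed.

Lemma bsum00 t z p : bsum t (theta_term z p) 0 0 = 1.
Proof.
rewrite /bsum /zsum big_ord_recl big_ord0 /bterm /theta_term addr0 !subr0.
by rewrite mulr0 addr0 /iqpoch qpoch0 /= !divr1 mulr1.
Qed.

Context (q0 : q != 0) (q1 : forall n, q ^+ n.+1 != 1).

Lemma theta_term_antisym p s : p != 0 ->
  theta_term (- p) p (-1 - s) = - theta_term (- p) p s.
Proof.
move=> p0; rewrite theta_term_half ?oppr_eq0 // !invrN !mulrN divff // mulN1r.
by rewrite expr2 mulfK.
Qed.

(** The difference of both sides is a multiple of the bilateral sum of weight
z^r p^(r(r-1)/2) q^((t+1) r) = (- p)^r p^(r(r-1)/2), which is odd about -1/2. *)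
Lemma bsum_raise t z p n : p != 0 -> z * q ^+ t.+1 = - p ->
  bsum t.+1 (theta_term z p) n t = bsum t.+1 (theta_term z p) n t.+1.
Proof.
move=> p0 zp; rewrite (@bsumE (n + t.+1)) //; last by lia.
pose F r := - q ^ (n%:Z + t.+1%:Z) * bterm t.+1 (theta_term (- p) p) n t.+1 r.
transitivity (zsum (n + t.+1)
    (fun r => bterm t.+1 (theta_term z p) n t.+1 r + F r)).
  apply: eq_zsum => r; rewrite /F /bterm.
  rewrite (_ : n%:Z + t%:Z + t.+1%:Z * r =
     n%:Z + t.+1%:Z + t.+1%:Z * r - 1); last by lia.
  rewrite -iqpoch_pred // -zp -theta_termM expfzDr // -exprz_exp -exprnP; ring.
rewrite zsum_add zsum_scale (zsum_odd_half (F := bterm _ (theta_term (- p) p) _ _)).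
- by rewrite mulr0 addr0.
- exact: bterm_supported.
move=> r; rewrite /bterm theta_term_antisym // mulNr; congr (- (_ * _)).
by rewrite mulrC; congr (iq _ * iq _); lia.
Qed.

(** One step of the Bailey chain relative to q^b, the two auxiliary parameters
being sent to infinity.  Since b <= t, no index r satisfies - b < t r < 0. *)
Lemma bailey_chain t z p n b : z != 0 -> p != 0 -> (0 < t)%N -> (b <= t)%N ->
  \sum_(m < n.+1) q ^+ (m * m + b * m)
     * (iq (n%:Z - m%:Z) * bsum t (theta_term z p) m b)
  = bsum t (theta_term (z * q ^+ (t * t + b * t)) (p * q ^+ (2 * t * t))) n b.
Proof.
move=> z0 p0 t0 bt; rewrite [RHS](@bsumE (n + b)) //.
transitivity (\sum_(m < n.+1) zsum (n + b) (fun r => theta_term z p r *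
   (q ^+ (m * m + b * m) * (iq (n%:Z - m%:Z) * (iq (m%:Z - t%:Z * r)
        * iq (m%:Z + b%:Z + t%:Z * r)))))).
  apply: eq_bigr => m _; rewrite (@bsumE (n + b)) //; last by have := ltn_ord m; lia.
  by rewrite -!zsum_scale; apply: eq_zsum => r; rewrite /bterm; ring.
rewrite /zsum exchange_big /=; apply: eq_bigr => i _.
move: (i%:Z - _) => r; rewrite -mulr_sumr q_vandermonde_shift //.
  2: by apply/orP; have [r0|r0] := lerP 0 r; [left | right]; nia.
rewrite /bterm [LHS]mulrA; congr (_ * _).
rewrite (_ : t%:Z * r * (t%:Z * r) + b%:Z * (t%:Z * r) =
   (t * t)%N%:Z * (r * r) + (b * t)%N%:Z * r); last by lia.
rewrite expfzDr // -(exprz_exp q (t * t)%N) -(exprz_exp q (b * t)%N) mulrA.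
rewrite theta_term_sqr ?expfz_neq0 // theta_termM -!exprnP -mulrA -exprD -exprM.
by rewrite (_ : (t * t * 2 = 2 * t * t)%N) //; lia.
Qed.

(** The finite form of Jacobi's triple product.  The proof raises b from 0 to 1
and then n by 1, as for the Bailey pairs. *)
Lemma finite_triple_product z n : z != 0 ->
  bsum 1 (theta_term (- z) q) n 0 * qpoch q q (2 * n)
  = qpoch z q n * qpoch (q / z) q n.
Proof.
move=> z0; have Nz0 : - z != 0 by rewrite oppr_eq0.
(* The summands for b and for b + 1 (or n + 1) are matched after a shift of s by 1. *)
have triS s : (tri (s + 1))%:Z = (tri s)%:Z + s by move: (triE s) (triE (s + 1)); nia.
pose u := theta_term (- z) q.
have step1 m : (1 - q ^+ (2 * m).+1) * bsum 1 u m 1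
    = (1 - q / z * q ^+ m) * bsum 1 u m 0.
  rewrite [bsum 1 u m 1](@bsumE m.+1) ?addn1 //.
  rewrite [RHS]mulrBl mul1r [X in _ = X - _](@bsumE m.+1) //; last by lia.
  rewrite [X in _ = _ - _ * X](@bsumE m.+1) //; last by lia.
  rewrite -[X in _ = _ - _ * X]zsum_shift; last first.
    by rewrite -[m in supported m]addn0; exact: bterm_supported.
  rewrite -[X in _ = _ + X]mulNr -!zsum_scale -zsum_add; apply: eq_zsum => s.
  rewrite /bterm !mul1r !addr0 (_ : m%:Z + (s + 1) = m%:Z + 1 + s); last by lia.
  rewrite (_ : m%:Z - (s + 1) = m%:Z - s - 1); last by lia.
  rewrite (_ : m%:Z + s = m%:Z + 1 + s - 1); last by lia.
  rewrite -!iqpoch_pred // /u /theta_term exprnP (exprnP _ (tri (s + 1))) triS.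
  rewrite (_ : (2 * m).+1%:Z = m%:Z + m%:Z + 1); last by lia.
  rewrite !expfzDr // -[q ^ (- s)]invr_expz -!exprnP ?expr1z; field.
  by rewrite expfz_neq0.
have step2 m : (1 - q ^+ (2 * m).+2) * bsum 1 u m.+1 0
    = (1 - z * q ^+ m) * bsum 1 u m 1.
  rewrite [bsum 1 u m.+1 0](@bsumE m.+2) //; last by lia.
  rewrite [RHS]mulrBl mul1r [X in _ = X - _](@bsumE m.+2) //; last by lia.
  rewrite [X in _ = _ - _ * X](@bsumE m.+2) //; last by lia.
  rewrite -[X in _ = _ - _ * X]zsum_shift_down; last first.
    by rewrite -[m.+1]addn1; exact: bterm_supported.
  rewrite -[X in _ = _ + X]mulNr -!zsum_scale -zsum_add; apply: eq_zsum => s.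
  rewrite -[s in LHS](subrK 1) -[s in X in _ = X + _](subrK 1).
  move: (s - 1) => {}s.
  rewrite /bterm !mul1r !addr0 (_ : m%:Z - (s + 1) = m.+1%:Z - (s + 1) - 1).
  2: by lia.
  rewrite (_ : m%:Z - s = m.+1%:Z - (s + 1)); last by lia.
  rewrite (_ : m%:Z + 1 + s = m.+1%:Z + (s + 1) - 1); last by lia.
  rewrite (_ : m%:Z + 1 + (s + 1) = m.+1%:Z + (s + 1)); last by lia.
  rewrite -!iqpoch_pred // /u /theta_term exprnP (exprnP _ (tri (s + 1))) triS.
  rewrite (_ : (2 * m).+2%:Z = m%:Z + m%:Z + 1 + 1); last by lia.
  rewrite (_ : m.+1%:Z - (s + 1) = m%:Z + (- s)); last by lia.
  rewrite (_ : m.+1%:Z + (s + 1) = m%:Z + s + 1 + 1); last by lia.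
  rewrite !expfzDr // -[q ^ (- s)]invr_expz -!exprnP ?expr1z; field.
  by rewrite expfz_neq0.
elim: n => [|n IH]; first by rewrite bsum00 muln0 !qpoch0 mulr1.
rewrite (_ : (2 * n.+1)%N = (2 * n).+2); last by lia.
rewrite !qpochS -!exprS; transitivity (((1 - q ^+ (2 * n).+2) * bsum 1 u n.+1 0)
   * (1 - q ^+ (2 * n).+1) * qpoch q q (2 * n)); first by rewrite /u; ring.
rewrite step2.
transitivity ((1 - z * q ^+ n) * ((1 - q ^+ (2 * n).+1) * bsum 1 u n 1)
   * qpoch q q (2 * n)); first by ring.
rewrite step1; transitivity ((1 - z * q ^+ n) * (1 - q / z * q ^+ n) *
  (bsum 1 u n 0 * qpoch q q (2 * n))); first by ring.
by rewrite IH; ring.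
Qed.

(** The finite q-binomial theorem. *)
Lemma q_binomial x n :
  \sum_(k < n.+1) (- x) ^+ k * q ^+ 'C(k, 2) *
     (iq k * (qpoch q q n * iq (n%:Z - k%:Z))) = qpoch x q n.
Proof.
elim: n => [|n IH].
  by rewrite big_ord_recl big_ord0 /iqpoch /= !qpoch0 !expr0 addr0 !(divr1, mulr1, invr1).
rewrite [RHS]qpochS -IH mulrBr mulr1.
transitivity (\sum_(k < n.+2) ((- x) ^+ k * q ^+ 'C(k, 2) *
     (iq k * (qpoch q q n * iq (n%:Z - k%:Z))) +
     (- x) ^+ k * q ^+ 'C(k, 2) * q ^ (n.+1%:Z - k%:Z) *
     (iq (k%:Z - 1) * (qpoch q q n * iq (n.+1%:Z - k%:Z))))).
  apply: eq_bigr => k _.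
  rewrite -iqpoch_pred // (_ : n%:Z - k%:Z = n.+1%:Z - k%:Z - 1); last by lia.
  have E : q ^+ n.+1 = q ^ (n.+1%:Z - k%:Z) * q ^ k by rewrite -expfzDr // subrK.
  rewrite -iqpoch_pred // qpochS -exprS E; ring.
rewrite big_split /= big_ord_recr /=.
rewrite [iq (n%:Z - n.+1%:Z)]iqpoch_neg; last by lia.
rewrite !mulr0 addr0 (big_ord_recl n.+1) [iq (ord0%:Z - 1)]iqpoch_neg // !(mul0r,
  mulr0) add0r.
congr (_ + _); rewrite mulr_suml -sumrN; apply: eq_bigr => k _.
rewrite lift0 (_ : k.+1%:Z - 1 = k); last by lia.
rewrite (_ : n.+1%:Z - k.+1%:Z = n%:Z - k%:Z); last by lia.
rewrite binS bin1 exprD exprS.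
have E : q ^+ n = q ^ (n%:Z - k%:Z) * q ^+ k.
  by rewrite [q ^+ k]exprnP -expfzDr // subrK.
rewrite E; ring.
Qed.

End BaileySums.

(** * Two Bailey pairs *)

Section BaileyPairs.
Context {K : numFieldType} (q : K) (q0 : q != 0).
Context (q1 : forall n, q ^+ n.+1 != 1).
Implicit Types (n m a b t : nat) (z p : K) (s r : int).

Local Notation Q := (q ^+ 2).
Local Notation iQ := (iqpoch Q).

Lemma sqr_expn_neq1 n : Q ^+ n.+1 != 1.
Proof. by rewrite -exprM mul2n doubleS. Qed.

Lemma one_sub_expn_neq0 n : 1 - q ^+ n.+1 != 0.
Proof. by rewrite subr_eq0 eq_sym. Qed.

Lemma one_add_expn_neq0 n : 1 + q ^+ n.+1 != 0.
Proof.
have := one_sub_expn_neq0 (n + n.+1); rewrite -addSn exprD.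
by rewrite (_ : 1 - _ = (1 - q ^+ n.+1) * (1 + q ^+ n.+1)); [rewrite mulf_eq0;
  case/norP | ring].
Qed.

Let Q0 : Q != 0. Proof. exact: expf_neq0. Qed.
Let Q1 := sqr_expn_neq1.

Local Notation cw := (theta_term (- q ^+ 8) (q ^+ 12)).

(** The discrepancy is a sum of terms odd about r = -1/2. *)
Lemma bsumC_step1 n :
  (1 - Q ^+ (2 * n).+1) * bsum Q 2 cw n 1 = bsum Q 2 cw n 0.
Proof.
rewrite !(@bsumE _ _ n.+2) //; try lia.
pose F s := theta_term (- q ^+ 12) (q ^+ 12) s *
  (iQ (n%:Z - 1 - 2%:Z * s) * iQ (n%:Z + 1 + 2%:Z * s)).
transitivity (zsum n.+2 (bterm Q 2 cw n 0) + Q ^ (n%:Z + 1) * zsum n.+2 F).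
  rewrite -!zsum_scale -zsum_add; apply: eq_zsum => s; rewrite /F /bterm.
  rewrite (_ : n%:Z - 1 - 2%:Z * s = n%:Z - 2%:Z * s - 1); last by lia.
  rewrite addr0 -[n%:Z in X in _ = X + _](addrK 1) [_ - 1 + 2%:Z * s]addrAC.
  rewrite (_ : n%:Z + 1 - 1 - 2%:Z * s = n%:Z - 2%:Z * s); last by lia.
  rewrite -!iqpoch_pred //.
  rewrite (_ : - q ^+ 12 = - q ^+ 8 * q ^+ 4); last by ring.
  rewrite -theta_termM exprnP (_ : (2 * n).+1%:Z = n%:Z + n%:Z + 1); last by lia.
  rewrite (_ : q ^+ 4 = Q ^+ 2); last by rewrite -exprM.
  rewrite !expfzDr // -!invr_expz -!exprz_exp -!exprnP ?expr1z. field.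
  by apply: expfz_neq0; rewrite expf_neq0.
rewrite (zsum_odd_half (F := F)) ?mulr0 ?addr0 // => [s sn|s]; rewrite /F.
  have [s0|s0] := lerP 0 s.
    by rewrite [iQ (_ - _ - _)]iqpoch_neg ?(mul0r, mulr0) //; lia.
  by rewrite [iQ (n%:Z + 1 + _)]iqpoch_neg ?(mul0r, mulr0) //; lia.
rewrite theta_term_antisym ?expf_neq0 // mulNr; congr (- (_ * _)).
by rewrite mulrC; congr (iQ _ * iQ _); lia.
Qed.

(** The discrepancy is a sum of terms odd about r = 0. *)
Lemma bsumC_step2 n : (1 - Q ^+ n.+1) * bsum Q 2 cw n.+1 0 = bsum Q 2 cw n 1.
Proof.
rewrite !(@bsumE _ _ n.+2) //; try lia.
pose F s := (theta_term (- q ^+ 4) (q ^+ 12) s - theta_term (- q ^+ 8) (q ^+ 12) s)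
  * (iQ (n.+1%:Z - 2%:Z * s) * iQ (n.+1%:Z + 2%:Z * s)).
transitivity (zsum n.+2 (bterm Q 2 cw n 1) + Q ^ n.+1%:Z * zsum n.+2 F).
  rewrite -!zsum_scale -zsum_add; apply: eq_zsum => s; rewrite /F /bterm.
  rewrite (_ : n%:Z - 2%:Z * s = n.+1%:Z - 2%:Z * s - 1); last by lia.
  rewrite (_ : n%:Z + 1 + 2%:Z * s = n.+1%:Z + 2%:Z * s); last by lia.
  rewrite addr0 -!iqpoch_pred //.
  have -> : theta_term (- q ^+ 4) (q ^+ 12) s
      = cw s * (Q ^ (2%:Z * s))^-1.
    rewrite -exprz_exp invr_expz -exprz_inv theta_termM; congr theta_term.
    by rewrite -exprnP; field.
  by rewrite exprnP expfzDr // -invr_expz; field; rewrite expfz_neq0.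
rewrite (zsum_odd _ (F := F)) ?mulr0 ?addr0 // => s;
  rewrite /F !theta_term_opp ?oppr_eq0 ?expf_neq0 //.
have -> : q ^+ 12 / - q ^+ 4 = - q ^+ 8 by field.
have -> : q ^+ 12 / - q ^+ 8 = - q ^+ 4 by field.
by rewrite -[RHS]mulNr opprB mulrN opprK; congr (_ * _); rewrite mulrC.
Qed.

Lemma sqr_expn n : Q ^+ n = q ^+ (2 * n). Proof. by rewrite exprM. Qed.

Lemma sqr_expn_double n : Q ^+ (2 * n) = (q ^+ (2 * n)) ^+ 2.
Proof. by rewrite exprAC. Qed.

(** The first Bailey pair, for b = 0 and b = 1. *)
Lemma bsumC n :
  bsum Q 2 cw n 0 * (qpoch q q (2 * n) * qpoch (- q) Q n) = 1 /\
  bsum Q 2 cw n 1 * (qpoch q q (2 * n).+1 * qpoch (- q) Q n.+1) = 1.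
Proof.
have half m : bsum Q 2 cw m 0 * (qpoch q q (2 * m) * qpoch (- q) Q m) = 1 ->
  bsum Q 2 cw m 1 * (qpoch q q (2 * m).+1 * qpoch (- q) Q m.+1) = 1.
  rewrite -bsumC_step1 => <-; rewrite !qpochS (exprS Q) sqr_expn_double sqr_expn; ring.
have main : bsum Q 2 cw n 0 * (qpoch q q (2 * n) * qpoch (- q) Q n) = 1.
  elim: n => [|n IH]; first by rewrite bsum00 muln0 !qpoch0 !mulr1.
  rewrite -(half n IH) -bsumC_step2 (_ : (2 * n.+1)%N = (2 * n).+2); last by lia.
  by rewrite !qpochS (exprS q (2 * n)) (exprS Q) !sqr_expn; ring.
by split=> //; apply: half.
Qed.

Local Notation ew := (theta_term (- q ^+ 2) (- q ^+ 3)).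

(** The discrepancy is a sum of terms odd about r = -1/2. *)
Lemma bsumG_step1 n :
  (1 - q ^+ (2 * n).+1) * bsum Q 1 ew n 1 = bsum Q 1 ew n 0.
Proof.
rewrite !(@bsumE _ _ n.+1) //; try lia.
pose F s := (q * theta_term (- q ^+ 4) (- q ^+ 3) s - ew s)
   * (iQ (n%:Z - s) * iQ (n%:Z + 1 + s)).
transitivity (zsum n.+1 (bterm Q 1 ew n 0) + q ^ (n%:Z + n%:Z + 1) * zsum n.+1 F).
  rewrite -!zsum_scale -zsum_add; apply: eq_zsum => s; rewrite /F /bterm !mul1r addr0.
  rewrite (_ : n%:Z + s = n%:Z + 1 + s - 1); last by lia.
  rewrite -!iqpoch_pred //.
  rewrite (_ : - q ^+ 4 = - q ^+ 2 * q ^+ 2); last by ring.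
  rewrite -theta_termM exprnP (_ : (2 * n).+1%:Z = n%:Z + n%:Z + 1); last by lia.
  by rewrite !expfzDr // !expr1z [Q ^ n%:Z]expfzMl; ring.
rewrite (zsum_odd_half (F := F)) ?mulr0 ?addr0 // => [s sn|s]; rewrite /F.
  have [s0|s0] := lerP 0 s.
    by rewrite [iQ (_ - _)]iqpoch_neg ?(mul0r, mulr0) //; lia.
  by rewrite [iQ (n%:Z + 1 + _)]iqpoch_neg ?(mul0r, mulr0) //; lia.
rewrite !theta_term_half ?oppr_eq0 ?expf_neq0 //.
have -> : (- q ^+ 3) ^+ 2 / - q ^+ 4 = - q ^+ 2 by field.
have -> : (- q ^+ 3) ^+ 2 / - q ^+ 2 = - q ^+ 4 by field.
have -> : (- q ^+ 3) / - q ^+ 2 = q by field.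
have -> : q * (- q ^+ 3 / - q ^+ 4 * ew s) = ew s by field.
rewrite -[RHS]mulNr; congr (_ * _); first by rewrite opprB.
by rewrite mulrC; congr (iQ _ * iQ _); lia.
Qed.

(** The discrepancy is a sum of terms odd about r = 1/2. *)
Lemma bsumG_step2 n : (1 - Q ^+ (2 * n).+2) * bsum Q 1 ew n.+1 0 = bsum Q 1 ew n 1.
Proof.
rewrite !(@bsumE _ _ n.+1) //; try lia.
pose F s := theta_term (- 1) (- q ^+ 3) s * (iQ (n.+1%:Z - s) * iQ (n%:Z + s)).
transitivity (zsum n.+1 (bterm Q 1 ew n 1) + Q ^ n.+1%:Z * zsum n.+1 F).
  rewrite -!zsum_scale -zsum_add; apply: eq_zsum => s; rewrite /F /bterm !mul1r.
  rewrite (_ : n%:Z - s = n.+1%:Z - s - 1); last by lia.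
  rewrite (_ : n%:Z + s = n.+1%:Z + s - 1); last by lia.
  rewrite (_ : n%:Z + 1 + s = n.+1%:Z + s); last by lia.
  rewrite addr0 -!iqpoch_pred //.
  have -> : theta_term (- 1) (- q ^+ 3) s = ew s / Q ^ s.
    rewrite invr_expz -exprz_inv theta_termM; congr theta_term.
    by field.
  rewrite exprnP (_ : (2 * n).+2%:Z = n.+1%:Z + n.+1%:Z); last by lia.
  by rewrite !expfzDr // -invr_expz; field; rewrite expfz_neq0.
rewrite -[zsum _ F]zsum_opp (zsum_odd_half (F := fun s => F (- s))) ?mulr0 ?addr0 //
  => [s sn|s]; rewrite /F.
  have [s0|s0] := lerP 0 s.
    by rewrite [iQ (n%:Z + _)]iqpoch_neg ?(mul0r, mulr0) //; lia.
  by rewrite [iQ (n.+1%:Z + _)]iqpoch_neg ?(mul0r, mulr0) //; lia.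
rewrite (_ : - (-1 - s) = 1 - (- s)); last by lia.
rewrite theta_term_one ?oppr_eq0 ?oner_neq0 ?expf_neq0 //.
have -> : (- 1)^-1 = - 1 :> K by field.
rewrite mulN1r mulNr.
congr (- (_ * _)).
by rewrite mulrC; congr (iQ _ * iQ _); lia.
Qed.

(** The second Bailey pair, for b = 0 and b = 1. *)
Lemma bsumG n :
  bsum Q 1 ew n 0 * (qpoch q q (2 * n) * qpoch (- q ^+ 2) Q n) = 1 /\
  bsum Q 1 ew n 1 * (qpoch q q (2 * n).+1 * qpoch (- q ^+ 2) Q n) = 1.
Proof.
have half m : bsum Q 1 ew m 0 * (qpoch q q (2 * m) * qpoch (- q ^+ 2) Q m) = 1 ->
  bsum Q 1 ew m 1 * (qpoch q q (2 * m).+1 * qpoch (- q ^+ 2) Q m) = 1.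
  rewrite -bsumG_step1 => <-; rewrite qpochS (exprS q (2 * m)); ring.
have main : bsum Q 1 ew n 0 * (qpoch q q (2 * n) * qpoch (- q ^+ 2) Q n) = 1.
  elim: n => [|n IH]; first by rewrite bsum00 muln0 !qpoch0 !mulr1.
  rewrite -(half n IH) -bsumG_step2 (_ : (2 * n.+1)%N = (2 * n).+2); last by lia.
  by rewrite !qpochS (exprS q (2 * n)) !(exprS Q) sqr_expn_double !sqr_expn; ring.
by split=> //; apply: half.
Qed.

End BaileyPairs.

(** * The truncated triple sum *)

Section TripleSum.
Context {K : numFieldType} (q : K) (q0 : q != 0).
Context (q1 : forall n, q ^+ n.+1 != 1).
Implicit Types (n m a b c e t N i j k : nat) (z p : K).

Local Notation Q := (q ^+ 2).
Local Notation iq := (iqpoch q).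
Local Notation iQ := (iqpoch Q).

Let Q0 : Q != 0. Proof. exact: expf_neq0. Qed.
Let Q1 := sqr_expn_neq1 q1.

Lemma big_ord_trunc (F : nat -> K) n N : (n <= N)%N ->
  (forall k, (n < k)%N -> F k = 0) -> \sum_(k < N.+1) F k = \sum_(k < n.+1) F k.
Proof.
move=> /subnK <- F0; elim: (N - n)%N => // d IH.
by rewrite addSn big_ord_recr /= IH F0 ?addr0 //; lia.
Qed.

(** The double sum obtained by applying two steps of the Bailey chain, relative
to Q^b and then to Q^a, to the sequence beta. *)
Definition double_bailey a b (beta : nat -> K) N : K :=
  \sum_(n < N.+1) Q ^+ (n * n + a * n) * (iQ (N%:Z - n%:Z) *
    \sum_(m < n.+1) Q ^+ (m * m + b * m) * (iQ (n%:Z - m%:Z) * beta m)).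

(** The hypothesis on u allows the parameter to change from b to a between the
two steps. *)
Lemma double_baileyE t z p a b N : z != 0 -> p != 0 ->
  (0 < t)%N -> (a <= t)%N -> (b <= t)%N ->
  (forall n, let u := theta_term (z * Q ^+ (t * t + b * t)) (p * Q ^+ (2 * t * t)) in
     bsum Q t u n b = bsum Q t u n a) ->
  double_bailey a b (fun m => bsum Q t (theta_term z p) m b) N =
  bsum Q t (theta_term (z * Q ^+ (t * t + b * t) * Q ^+ (t * t + a * t))
                       (p * Q ^+ (2 * t * t) * Q ^+ (2 * t * t))) N a.
Proof.
move=> z0 p0 t0 at_ bt ab.
rewrite -bailey_chain ?mulf_neq0 ?expf_neq0 //; apply: eq_bigr => n _.
by rewrite bailey_chain // ab.
Qed.

(** The exponents of the theorem: the four series correspond to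
(a, b, c) = (0, 0, 0), (0, 0, 1), (0, 1, 1) and (1, 1, 1). *)
Definition expo a b c i j k : nat :=
  (i * i + 2 * j * j + k * k + 2 * i * j + i * k
   + a * (i + 2 * j) + b * i + c * k)%N.

(** The general term of the triple series, multiplied by the two factors
(Q;Q)_(N-m) / (Q;Q)_(N-m-k) and (Q;Q)_N / (Q;Q)_(N-m-j), m = i./2.  They tend
to 1 and make the support finite, and with them the finite q-binomial theorem
applies to the sum over k. *)
Definition trunc_term a b c N i j k : K :=
  q ^+ expo a b c i j k * (iq i * iQ j * iQ k)
  * (qpoch Q Q (N - i./2) * iQ (N%:Z - i./2%:Z - k%:Z))
  * (qpoch Q Q N * iQ (N%:Z - i./2%:Z - j%:Z)).

Lemma trunc_sum_k a b c e m j N : (e <= 1)%N -> (m <= N)%N ->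
  \sum_(k < N.+1) trunc_term a b c N (2 * m + e) j k =
  q ^+ expo a b c (2 * m + e) j 0 * (iq (2 * m + e)%N * iQ j)
  * (qpoch Q Q N * iQ (N%:Z - m%:Z - j%:Z))
  * qpoch (- q ^+ (2 * m + e + c).+1) Q (N - m).
Proof.
move=> e1 mN; have im : ((2 * m + e)./2 = m)%N by lia.
rewrite (big_ord_trunc (n := (N - m)%N)) ?leq_subr //.
  2: by move=> k mk; rewrite /trunc_term im [iQ (_ - k%:Z)]iqpoch_neg ?(mulr0, mul0r)
    //; lia.
rewrite -[X in _ = _ * X](q_binomial Q0 Q1) mulr_sumr; apply: eq_bigr => k _.
rewrite /trunc_term im opprK -!exprM.
have -> : expo a b c (2 * m + e) j k =
   (expo a b c (2 * m + e) j 0 + ((2 * m + e + c).+1 * k + 2 * 'C(k, 2)))%N.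
  by move: (triE k%:Z) => /=; rewrite /expo; nia.
rewrite !exprD (_ : N%:Z - m%:Z = (N - m)%N%:Z); [ring | lia].
Qed.

(** The part of the truncated triple sum with i of parity e. *)
Lemma trunc_sum a b c e N : (e <= 1)%N ->
  \sum_(m < N.+1) \sum_(j < N.+1) \sum_(k < N.+1) trunc_term a b c N (2 * m + e) j k
  = q ^+ (e * (1 + a + b)) * (qpoch Q Q N * qpoch (- q ^+ (1 + e + c)) Q N
    * double_bailey (e + a) (e + b)
       (fun m => iq (2 * m + e)%N / qpoch (- q ^+ (1 + e + c)) Q m) N).
Proof.
move=> e1; set x := - q ^+ (1 + e + c).
have x0 m : qpoch x Q m != 0.
  elim: m => [|m IH]; first by rewrite qpoch0 oner_neq0.
  rewrite qpochS mulf_neq0 // /x mulNr opprK -exprM -exprD.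
  by rewrite !add1n !addSn one_add_expn_neq0.
(* The summand in terms of m and n = m + j. *)
pose G m n : K := Q ^+ (n * n + (e + a) * n) * iQ (N%:Z - n%:Z) *
  (Q ^+ (m * m + (e + b) * m) * (iQ (n%:Z - m%:Z) * (iq (2 * m + e)%N / qpoch x Q m))).
transitivity (q ^+ (e * (1 + a + b)) * (qpoch Q Q N * qpoch x Q N
   * \sum_(m < N.+1) \sum_(n < N.+1) G m n)).
  rewrite !mulr_sumr; apply: eq_bigr => m _; have mN : (m <= N)%N by rewrite -ltnS.
  pose H j := q ^+ expo a b c (2 * m + e) j 0 * (iq (2 * m + e)%N * iQ j)
    * (qpoch Q Q N * iQ (N%:Z - m%:Z - j%:Z))
    * qpoch (- q ^+ (2 * m + e + c).+1) Q (N - m).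
  transitivity (\sum_(j < N.+1) H j).
    by apply: eq_bigr => j _; exact: trunc_sum_k.
  rewrite [LHS](big_ord_trunc (n := (N - m)%N)) ?leq_subr //.
    2: by move=> j mj; rewrite /H [iQ (_ - j%:Z)]iqpoch_neg ?(mulr0, mul0r) //; lia.
  rewrite /H.
  move EF : (G m) => F.
  rewrite [X in _ = _ * (_ * X)](_ : _ = \sum_(0 <= n < N.+1) F n);
    last by rewrite big_mkord.
  rewrite (big_cat_nat (n := m)) //=; last by lia.
  rewrite [X in _ = _ * (_ * (X + _))]big_nat_cond [X in _ = _ * (_ * (X + _))]big1
    ?add0r => [|n]; last first.
    rewrite andbT -EF /G => /= nm.
    by rewrite [iQ (n%:Z - _)]iqpoch_neg ?(mulr0, mul0r) //; lia.
  rewrite -[\sum_(m <= i < N.+1) F i]/(\sum_(0 + m <= i < N.+1) F i) big_addn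
    big_mkord -EF /G subSn //.
  rewrite !mulr_sumr; apply: eq_bigr => j _.
  rewrite (_ : (j + m)%N%:Z - m%:Z = j); last by lia.
  rewrite (_ : N%:Z - (j + m)%N%:Z = N%:Z - m%:Z - j%:Z); last by lia.
  have -> : qpoch x Q N = qpoch x Q m * qpoch (x * Q ^+ m) Q (N - m).
    by rewrite -qpochD subnKC.
  rewrite (_ : - q ^+ (2 * m + e + c).+1 = x * Q ^+ m).
    2: by rewrite /x mulNr -exprM -exprD; congr (- _ ^+ _); lia.
  have -> : expo a b c (2 * m + e) j 0 = (e * (1 + a + b)
    + (2 * ((j + m) * (j + m) + (e + a) * (j + m)) + 2 * (m * m + (e + b) * m)))%N.
    have ee : (e * e = e)%N by case: (e) e1 => [|[]].
    by rewrite /expo; nia.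
  by rewrite (exprD q (e * _)) (exprD q (2 * _)) !(exprM q 2); field.
congr (_ * (_ * _)); rewrite exchange_big /=; apply: eq_bigr => n _.
have nN : (n <= N)%N by rewrite -ltnS.
rewrite (@big_ord_trunc (fun m => G m n) n N nN) /G.
  by rewrite !mulr_sumr; apply: eq_bigr => m _; ring.
by move=> m nm; rewrite [iQ (n%:Z - _)]iqpoch_neg ?(mulr0, mul0r) //; lia.
Qed.

End TripleSum.

(** * Evaluation of the eight double sums *)

Section Evaluations.
Context {K : numFieldType} (q : K) (q0 : q != 0).
Context (q1 : forall n, q ^+ n.+1 != 1).
Implicit Types (n m a b c e t N i j k : nat) (z p : K).

Local Notation Q := (q ^+ 2).
Local Notation iq := (iqpoch q).

Let Q0 : Q != 0. Proof. exact: expf_neq0. Qed.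
Let Q1 := sqr_expn_neq1 q1.

Lemma eq_double_bailey a b (beta beta' : nat -> K) N : beta =1 beta' ->
  double_bailey q a b beta N = double_bailey q a b beta' N.
Proof.
move=> bb; apply: eq_bigr => n _; congr (_ * (_ * _)).
by apply: eq_bigr => m _; rewrite bb.
Qed.

Lemma double_bailey_scale a b (x : K) beta N :
  double_bailey q a b (fun m => x * beta m) N = x * double_bailey q a b beta N.
Proof.
rewrite /double_bailey mulr_sumr; apply: eq_bigr => n _.
rewrite [RHS]mulrCA [x * (_ * _)]mulrCA; congr (_ * (_ * _)).
by rewrite mulr_sumr; apply: eq_bigr => m _; ring.
Qed.

(** The sequences to which the Bailey chain is applied. *)
Let beta e c m : K := iq (2 * m + e)%N / qpoch (- q ^+ (1 + e + c)) Q m.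

Lemma eq_inv3 (x y z : K) : x * (y * z) = 1 -> y^-1 / z = x.
Proof.
move=> xyz; have := oner_neq0 K; rewrite -xyz !mulf_eq0 !negb_or => /and3P[_ y0 z0].
by rewrite -[x]mulr1 -invfM; apply: (mulIf (mulf_neq0 y0 z0));
  rewrite mulVf ?mulf_neq0 // mulr1.
Qed.

Lemma beta00 m : beta 0 0 m = bsum Q 2 (theta_term (- q ^+ 8) (q ^+ 12)) m 0.
Proof. by apply: eq_inv3; rewrite addn0 expr1; case: (bsumC q0 q1 m). Qed.

Lemma beta10 m : beta 1 0 m = bsum Q 1 (theta_term (- q ^+ 2) (- q ^+ 3)) m 1.
Proof. by apply: eq_inv3; rewrite addn1; case: (bsumG q0 q1 m). Qed.

(** The weight of the pair bsumG reflected by r -> - r. *)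
Lemma beta01 m : beta 0 1 m = bsum Q 1 (theta_term q (- q ^+ 3)) m 0.
Proof.
rewrite -bsum_opp; apply: eq_inv3; rewrite addn0.
have <- := (bsumG q0 q1 m).1; congr (_ * _); apply: eq_bsum => r.
rewrite theta_term_opp ?oppr_eq0 ?expf_neq0 //; congr theta_term.
by field.
Qed.

Lemma beta01' m : beta 0 1 m = bsum Q 1 (theta_term q (- q ^+ 3)) m 1.
Proof.
rewrite beta01 bsum_raise ?oppr_eq0 ?expf_neq0 //.
by rewrite opprK expr1 -exprS.
Qed.

Lemma beta11 m :
  beta 1 1 m = (1 + q) * bsum Q 2 (theta_term (- q ^+ 8) (q ^+ 12)) m 1.
Proof.
have [_] := bsumC q0 q1 m; rewrite (qpochSl (- q)) opprK => H.
rewrite /beta; apply: eq_inv3; rewrite addn1 -[RHS]H.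
have -> : - q * Q = - q ^+ (1 + 1 + 1) by ring.
ring.
Qed.

Lemma beta11' m :
  beta 1 1 m = (1 + q) * bsum Q 2 (theta_term (- q ^+ 8) (q ^+ 12)) m 2.
Proof.
rewrite beta11 bsum_raise ?expf_neq0 //.
ring.
Qed.

Let neq0 := (mulf_neq0, expf_neq0, oppr_eq0, q0).

(** In the names below the digits are the parameters a, b, c of expo, and even
or odd is the parity of the index i. *)
Lemma eval_000_even N : double_bailey q 0 0 (beta 0 0) N =
  bsum Q 2 (theta_term (- q ^+ 24) (q ^+ 44)) N 0.
Proof.
rewrite (eq_double_bailey _ _ _ beta00) double_baileyE ?neq0 //.
by congr bsum; congr theta_term; ring.
Qed.

Lemma eval_000_odd N : double_bailey q 1 1 (beta 1 0) N =
  bsum Q 1 (theta_term (- q ^+ 10) (- q ^+ 11)) N 1.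
Proof.
rewrite (eq_double_bailey _ _ _ beta10) double_baileyE ?neq0 //.
by congr bsum; congr theta_term; ring.
Qed.

Lemma eval_001_even N : double_bailey q 0 0 (beta 0 1) N =
  bsum Q 1 (theta_term (q ^+ 5) (- q ^+ 11)) N 0.
Proof.
rewrite (eq_double_bailey _ _ _ beta01) double_baileyE ?neq0 //.
by congr bsum; congr theta_term; ring.
Qed.

Lemma eval_001_odd N : double_bailey q 1 1 (beta 1 1) N =
  (1 + q) * bsum Q 2 (theta_term (- q ^+ 32) (q ^+ 44)) N 1.
Proof.
rewrite (eq_double_bailey _ _ _ beta11) double_bailey_scale double_baileyE ?neq0 //.
by congr (_ * bsum _ _ _ _ _); congr theta_term; ring.
Qed.

Lemma eval_011_even N : double_bailey q 0 1 (beta 0 1) N =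
  bsum Q 1 (theta_term (q ^+ 7) (- q ^+ 11)) N 0.
Proof.
rewrite (eq_double_bailey _ _ _ beta01') double_baileyE ?neq0 //.
  by congr bsum; congr theta_term; ring.
move=> n u; rewrite /u -bsum_raise ?neq0 //; ring.
Qed.

Lemma eval_011_odd N : double_bailey q 1 2 (beta 1 1) N =
  (1 + q) * bsum Q 2 (theta_term (- q ^+ 36) (q ^+ 44)) N 1.
Proof.
rewrite (eq_double_bailey _ _ _ beta11') double_bailey_scale double_baileyE ?neq0 //.
  by congr (_ * bsum _ _ _ _ _); congr theta_term; ring.
move=> n u; rewrite /u -bsum_raise ?neq0 //; ring.
Qed.

Lemma eval_111_even N : double_bailey q 1 1 (beta 0 1) N =
  bsum Q 1 (theta_term (q ^+ 9) (- q ^+ 11)) N 1.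
Proof.
rewrite (eq_double_bailey _ _ _ beta01') double_baileyE ?neq0 //.
by congr bsum; congr theta_term; ring.
Qed.

Lemma eval_111_odd N : double_bailey q 2 2 (beta 1 1) N =
  (1 + q) * bsum Q 2 (theta_term (- q ^+ 40) (q ^+ 44)) N 2.
Proof.
rewrite (eq_double_bailey _ _ _ beta11') double_bailey_scale double_baileyE ?neq0 //.
by congr (_ * bsum _ _ _ _ _); congr theta_term; ring.
Qed.

End Evaluations.

(** * Dominated convergence for unordered sums *)

Section Tannery.
Context {K : numFieldType} {T : choiceType}.
Implicit Types (F g : T -> K) (f : nat -> T -> K) (A B J : seq T).

(** Unconditional summation of a family indexed by T; has_sum3 is the case of
triples of natural numbers. *)
Definition has_sum F (l : K) : Prop :=
  summability.partial_sum F @ summability.totally --> l.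

(** The sums of g over finite sets avoiding a large enough finite set are
arbitrarily small; for g >= 0 this is summability. *)
Definition tail_small g := forall eps : K, 0 < eps -> exists J, forall A,
  uniq A -> (forall t, t \in A -> t \notin J) -> \sum_(t <- A) g t < eps.

Lemma sum_subset F A B : uniq A -> uniq B -> {subset A <= B} ->
  \sum_(t <- B) F t = \sum_(t <- A) F t + \sum_(t <- B | t \notin A) F t.
Proof.
move=> uA uB AB; rewrite (bigID (mem A)) /=; congr (_ + _).
rewrite -big_filter; apply: perm_big; apply: uniq_perm => // [|t].
  exact: filter_uniq.
by rewrite mem_filter; case: (boolP (t \in A)) => // /AB ->.
Qed.

Lemma sum_zero_outside F A B : uniq A -> uniq B -> {subset A <= B} ->
  (forall t, t \notin A -> F t = 0) -> \sum_(t <- B) F t = \sum_(t <- A) F t.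
Proof.
move=> uA uB AB F0; rewrite (sum_subset _ uA uB AB) [X in _ + X]big1 ?addr0 //.
Qed.

Lemma tail_bound F g J A eps : (forall t, `|F t| <= g t) -> uniq A ->
  (forall B, uniq B -> (forall t, t \in B -> t \notin J) -> \sum_(t <- B) g t < eps) ->
  `|\sum_(t <- A | t \notin J) F t| < eps.
Proof.
move=> Fg uA gJ; apply: le_lt_trans (ler_norm_sum _ _ _) _.
apply: (@le_lt_trans _ _ (\sum_(t <- A | t \notin J) g t)).
  exact: ler_sum.
rewrite -big_filter; apply: gJ; first exact: filter_uniq.
by move=> t; rewrite mem_filter => /andP[].
Qed.

Context (f : nat -> T -> K) (F g : T -> K) (A : nat -> seq T).
Context (g_tail : tail_small g) (uA : forall N, uniq (A N)).
Context (f0 : forall N t, t \notin A N -> f N t = 0).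
Context (fg : forall N t, `|f N t| <= g t).
Context (fF : forall t, f ^~ t @ \oo --> F t).

Lemma limit_dominated t : `|F t| <= g t.
Proof.
have g0 : 0 <= g t by apply: le_trans (fg 0 t).
rewrite real_leNgt ?normr_real ?ger0_real //; apply/negP => lt.
have e0 : 0 < `|F t| - g t by rewrite subr_gt0.
have [N _ /(_ N (leqnn N)) /=] := (@cvgrPdist_lt _ _ _ _ _ _ _).1 (fF (t := t)) _ e0.
move=> h; suff : `|F t - f N t| < `|F t - f N t| by rewrite ltxx.
apply: lt_le_trans h _; apply: le_trans (lerB_dist _ _).
by rewrite lerD2l lerN2.
Qed.

Lemma cvg_sum_seq J :
  (fun N => \sum_(t <- J) f N t) @ \oo --> \sum_(t <- J) F t.
Proof. by apply: cvg_big => //; exact: add_continuous. Qed.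

(** Tannery's theorem: if f N -> F pointwise, dominated by the summable family g,
then the sums of F over large finite sets are close to the total sum of f N
for large N. *)
Lemma tannery_close eps : 0 < eps -> exists2 J, uniq J &
  \forall N \near \oo, forall B, uniq B -> {subset J <= B} ->
    `|\sum_(t <- B) F t - \sum_(t <- A N) f N t| < eps.
Proof.
move=> eps0; have e3 : 0 < eps / 3%:R by rewrite divr_gt0 ?ltr0n.
have [J' J'P] := g_tail e3; exists (undup J'); first exact: undup_uniq.
move: (undup J') (undup_uniq J') (mem_undup J') => J uJ JJ'.
have /cvgrPdist_lt /(_ _ e3) := @cvg_sum_seq J.
apply: filterS => N HN B uB JB.
have JP C : uniq C -> (forall t, t \in C -> t \notin J) -> \sum_(t <- C) g t < eps / 3%:R.
  by move=> uC CJ; apply: J'P => // t /CJ; rewrite JJ'.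
(* Enlarging A N by J does not change the sum of f N, which vanishes outside A N. *)
pose A' := undup (A N ++ J).
have uA' : uniq A' by exact: undup_uniq.
rewrite -(@sum_zero_outside _ (A N) A') //; [|by move=> t tA;
  rewrite mem_undup mem_cat tA | exact: f0].
rewrite (sum_subset _ uJ uB JB) (sum_subset (f N) uJ uA').
  2: by move=> t tJ; rewrite mem_undup mem_cat tJ orbT.
set a := \sum_(t <- J) F t; set b := \sum_(t <- B | _) F t.
set c := \sum_(t <- J) f N t; set d := \sum_(t <- A' | _) f N t.
have -> : a + b - (c + d) = (a - c) + b - d by ring.
have -> : eps = eps / 3%:R + eps / 3%:R + eps / 3%:R by field.
apply: le_lt_trans (ler_normB _ _) _; apply: ltrD.
  apply: le_lt_trans (ler_normD _ _) _; apply: ltrD => //.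
  by apply: (tail_bound limit_dominated uB).
by apply: (tail_bound (fg N) uA').
Qed.

(** Under the same hypotheses, the limit of the total sums of f N is the sum of F. *)
Lemma tannery_has_sum l : (fun N => \sum_(t <- A N) f N t) @ \oo --> l ->
  has_sum F l.
Proof.
move=> /cvgrPdist_lt Al; apply/(@cvgrPdist_lt _ _ _ _ summability.totally_filter).
move=> eps eps0; have e2 : 0 < eps / 2%:R by rewrite divr_gt0 ?ltr0n.
have [J uJ HJ] := tannery_close e2.
have [N [HN1 HN2]] : exists N, `|l - \sum_(t <- A N) f N t| < eps / 2%:R /\
    forall B, uniq B -> {subset J <= B} ->
    `|\sum_(t <- B) F t - \sum_(t <- A N) f N t| < eps / 2%:R.
  have := filterI (Al _ e2) HJ; case => N _ /(_ N (leqnn N)) H; by exists N.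
exists [fset t in J]%fset => // B /= /fsubsetP JB.
rewrite /summability.partial_sum -(big_seq_fsetE _ _ xpredT F).
have HB := HN2 B (fset_uniq B).
have {}HB := HB (fun t tJ => JB t ltac:(by rewrite inE)).
rewrite -(subrKA (\sum_(t <- A N) f N t)) (_ : eps = eps / 2%:R + eps / 2%:R);
  last by field.
by apply: le_lt_trans (ler_normD _ _) _; rewrite ltrD // distrC.
Qed.

End Tannery.

(** Two dominated approximations of the same family have total sums with the same
limit. *)
Lemma tannery_transfer (K : numFieldType) (T : choiceType) (f f' : nat -> T -> K)
    (F g g' : T -> K) (A A' : nat -> seq T) (l : K) :
  tail_small g -> tail_small g' ->
  (forall N, uniq (A N)) -> (forall N, uniq (A' N)) ->
  (forall N t, t \notin A N -> f N t = 0) ->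
  (forall N t, t \notin A' N -> f' N t = 0) ->
  (forall N t, `|f N t| <= g t) -> (forall N t, `|f' N t| <= g' t) ->
  (forall t, f ^~ t @ \oo --> F t) -> (forall t, f' ^~ t @ \oo --> F t) ->
  (fun N => \sum_(t <- A N) f N t) @ \oo --> l ->
  (fun N => \sum_(t <- A' N) f' N t) @ \oo --> l.
Proof.
move=> gt gt' uA uA' f0 f0' fg fg' fF fF' /cvgrPdist_lt Al.
apply/cvgrPdist_lt => eps eps0.
have e3 : 0 < eps / 3%:R by rewrite divr_gt0 ?ltr0n.
have [J uJ HJ] := tannery_close gt uA f0 fg fF e3.
have [J' uJ' HJ'] := tannery_close gt' uA' f0' fg' fF' e3.
near=> N.
pose B := undup (J ++ J').
have uB : uniq B by exact: undup_uniq.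
have H1 : `|l - \sum_(t <- A N) f N t| < eps / 3%:R by near: N; exact: Al.
have H2 : `|\sum_(t <- B) F t - \sum_(t <- A N) f N t| < eps / 3%:R.
  have JB : {subset J <= B} by move=> t; rewrite mem_undup mem_cat => ->.
  by move: (B) uB JB; near: N.
have H3 : `|\sum_(t <- B) F t - \sum_(t <- A' N) f' N t| < eps / 3%:R.
  have JB : {subset J' <= B} by move=> t; rewrite mem_undup mem_cat orbC => ->.
  by move: (B) uB JB; near: N.
move: H1 H2 H3; set a := \sum_(t <- A N) _; set b := \sum_(t <- B) _;
  set c := \sum_(t <- A' N) _.
move=> H1 H2 H3.
have -> : l - c = (l - a) - (b - a) + (b - c) by ring.
have -> : eps = eps / 3%:R + eps / 3%:R + eps / 3%:R by field.
apply: le_lt_trans (ler_normD _ _) _; apply: ltrD => //.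
by apply: le_lt_trans (ler_normB _ _) _; apply: ltrD.
Unshelve. all: by end_near.
Qed.

(** * Geometric majorants *)

Section GeometricTails.
Context {K : numFieldType}.

(** A nonnegative family whose sums over an exhausting sequence of finite sets
converge from below is summable. *)
Lemma tail_small_exhaust (T : choiceType) (g : T -> K) (J : nat -> seq T) (L : K) :
  (forall t, 0 <= g t) -> (forall n, uniq (J n)) ->
  (forall t, exists n, forall m, (n <= m)%N -> t \in J m) ->
  (forall n, \sum_(t <- J n) g t <= L) ->
  (fun n => \sum_(t <- J n) g t) @ \oo --> L -> tail_small g.
Proof.
move=> g0 uJ Jcover JL /cvgrPdist_lt HL eps eps0.
have [n _ /(_ n (leqnn n)) /= Hn] := HL _ eps0.
exists (J n) => A uA AJ.
have [m nm AJm] : exists2 m, (n <= m)%N &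
    forall m', (m <= m')%N -> {subset A ++ J n <= J m'}.
  elim: (A ++ J n) => [|t s [m nm sm]]; first by exists n.
  have [m' Hm'] := Jcover t; exists (maxn m m'); first by rewrite leq_max nm.
  move=> k; rewrite geq_max => /andP[mk mk'] u; rewrite inE => /orP[/eqP ->|us].
    exact: Hm'.
  exact: sm us.
have uAJ : uniq (A ++ J n).
  rewrite cat_uniq uA uJ andbT /=; apply/hasPn => t tJ.
  by apply/negP => /AJ; rewrite tJ.
have : \sum_(t <- A) g t + \sum_(t <- J n) g t <= L.
  rewrite -big_cat /=; apply: le_trans (JL m).
  rewrite (sum_subset _ uAJ (uJ m) (AJm m (leqnn m))) lerDl.
  exact: sumr_ge0.
rewrite -lerBrDr => /le_lt_trans; apply.
by move: Hn; rewrite ger0_norm ?subr_ge0.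
Qed.

Lemma tail_small_scale (T : choiceType) (g : T -> K) (c : K) : 0 <= c ->
  (forall t, 0 <= g t) -> tail_small g -> tail_small (fun t => c * g t).
Proof.
move=> c0 g0 gt eps eps0; have c1 : 0 < c + 1 by rewrite ltr_wpDl.
have [J HJ] := gt _ (divr_gt0 eps0 c1).
exists J => A uA AJ; rewrite -mulr_sumr.
have := HJ A uA AJ; rewrite ltr_pdivlMr // mulrC; apply: le_lt_trans.
by rewrite ler_wpM2r ?sumr_ge0 // lerDl.
Qed.

(** The triples (i, j, k) with i < a, j < b and k < c. *)
Definition box a b c : seq (nat * nat * nat) :=
  [seq (ij, k) | ij <- [seq (i, j) | i <- index_iota 0 a, j <- index_iota 0 b],
                 k <- index_iota 0 c].

Lemma sum_box a b c (F : nat * nat * nat -> K) : \sum_(t <- box a b c) F t =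
  \sum_(i < a) \sum_(j < b) \sum_(k < c) F (i : nat, j : nat, k : nat).
Proof.
rewrite big_allpairs big_allpairs big_mkord.
by apply: eq_bigr => i _; rewrite big_mkord; apply: eq_bigr => j _; rewrite big_mkord.
Qed.

Lemma mem_box a b c i j k :
  ((i, j, k) \in box a b c) = [&& (i < a)%N, (j < b)%N & (k < c)%N].
Proof.
apply/allpairsP/and3P => [[[ij k'] /= []]|[ia jb kc]].
  case/allpairsP => [[i' j'] /= []]; rewrite !mem_index_iota /= => ia jb ->.
  by move=> kc [-> -> ->]; split.
exists ((i, j), k); split; rewrite ?mem_index_iota //.
by apply/allpairsP; exists (i, j); rewrite !mem_index_iota.
Qed.

Lemma box_uniq a b c : uniq (box a b c).
Proof.
rewrite allpairs_uniq ?iota_uniq // => [|[x y] [x' y'] _ _ [-> ->] //].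
by rewrite allpairs_uniq ?iota_uniq // => -[x y] [x' y'] _ _ [-> ->].
Qed.

(** The integers of absolute value at most n. *)
Definition zrange n : seq int := [seq i%:Z - n%:Z | i <- index_iota 0 (2 * n).+1].

Lemma sum_zrange n (F : int -> K) : \sum_(s <- zrange n) F s = zsum n F.
Proof. by rewrite big_map big_mkord. Qed.

Lemma mem_zrange n s : (s \in zrange n) = (`|s| <= n)%N.
Proof.
apply/mapP/idP => [[m] | sn]; first by rewrite mem_index_iota => ilt ->; move: ilt;
  rewrite ?mem_iota; lia.
by exists (absz (s + n%:Z)); rewrite ?mem_index_iota; lia.
Qed.

Lemma zrange_uniq n : uniq (zrange n).
Proof. by rewrite map_inj_uniq ?iota_uniq // => i j; lia. Qed.

Context (x : K) (x0 : 0 <= x) (x1 : x < 1).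
Context (xn : (fun n => x ^+ n) @ \oo --> (0 : K)).

Let y0 : 0 < 1 - x. Proof. by rewrite subr_gt0. Qed.

Lemma tail_small_box : tail_small (fun t : nat * nat * nat => x ^+ (t.1.1 + t.1.2 + t.2)).
Proof.
pose S n : K := (1 - x ^+ n) / (1 - x).
have SE n : \sum_(i < n) x ^+ i = S n.
  by rewrite /S -opprB subrX1 -mulNr opprB mulrC mulKf // gt_eqF.
have E n : \sum_(t <- box n n n) x ^+ (t.1.1 + t.1.2 + t.2) = S n * S n * S n.
  rewrite sum_box -!SE mulr_suml; rewrite mulr_suml; apply: eq_bigr => i _.
  rewrite [x ^+ i * _]mulr_sumr mulr_suml; apply: eq_bigr => j _.
  by rewrite mulr_sumr; apply: eq_bigr => k _; rewrite /= !exprD.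
apply: (@tail_small_exhaust _ _ (fun n => box n n n) ((1 - x)^-1 * (1 - x)^-1 * (1 -
  x)^-1)).
- by move=> t; exact: exprn_ge0.
- by move=> n; exact: box_uniq.
- move=> [[i j] k]; exists (i + j + k).+1 => m ijk; rewrite mem_box.
  by apply/and3P; split; lia.
- move=> n; rewrite E; have Sn0 : 0 <= S n.
    by rewrite -SE; apply: sumr_ge0 => i _; exact: exprn_ge0.
  have Sn : S n <= (1 - x)^-1.
    rewrite /S -[leRHS]mul1r; apply: ler_wpM2r; first by rewrite invr_ge0 ltW.
    by rewrite gerBl exprn_ge0.
  by apply: ler_pM => //; [exact: mulr_ge0 | exact: ler_pM].
- under eq_fun do rewrite E.
  have Sl : S @ \oo --> (1 - x)^-1.
    suff : S @ \oo --> (1 - 0) * (1 - x)^-1 by rewrite subr0 mul1r.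
    by apply: cvgM; [apply: cvgB; [exact: cvg_cst | exact: xn] | exact: cvg_cst].
  by apply: cvgM => //; apply: cvgM.
Qed.

Lemma tail_small_zrange : tail_small (fun s : int => x ^+ `|s|).
Proof.
pose S n : K := (1 + x - 2%:R * (x * x ^+ n)) / (1 - x).
have E n : \sum_(s <- zrange n) x ^+ `|s|%N = S n.
  rewrite sum_zrange; have d0 : 1 - x != 0 by rewrite gt_eqF.
  apply: (mulIf d0).
  rewrite /S mulfVK ?gt_eqF //; elim: n => [|n IH].
    by rewrite /zsum big_ord_recl big_ord0 subrr absz0 expr0; ring.
  rewrite zsumS !mulrDl IH abszN absz_nat exprS; ring.
apply: (@tail_small_exhaust _ _ zrange ((1 + x) / (1 - x))).
- by move=> t; exact: exprn_ge0.
- exact: zrange_uniq.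
- by move=> s; exists `|s|%N => m; rewrite mem_zrange.
- move=> n; rewrite E /S; apply: ler_wpM2r; first by rewrite invr_ge0 ltW.
  by rewrite gerBl !mulr_ge0 ?exprn_ge0 // ler0n.
- under eq_fun do rewrite E.
  apply: cvgM; last exact: cvg_cst.
  suff : (fun n => 1 + x - 2%:R * (x * x ^+ n)) @ \oo --> 1 + x - 2%:R * (x * 0).
    by rewrite !mulr0 subr0.
  apply: cvgB; first exact: cvg_cst.
  apply: cvgM; first exact: cvg_cst.
  by apply: cvgM => //; exact: cvg_cst.
Qed.

End GeometricTails.

(** * Infinite products *)

(** Powers of elements of norm less than 1 tend to 0; this holds in archimedean
fields. *)
Definition geometric_null (K : numFieldType) :=
  forall x : K, `|x| < 1 -> (fun n => x ^+ n) @ \oo --> (0 : K).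

(** Sequences whose increments decrease geometrically converge: the only
consequence of completeness that convergence of infinite products requires. *)
Definition geometric_complete (K : numFieldType) :=
  forall (u : nat -> K) (c r : K), 0 <= r -> r < 1 ->
    (forall n, `|u n.+1 - u n| <= c * r ^+ n) -> cvgn u.

Section InfiniteProducts.
Context {K : numFieldType}.
Context (geo : geometric_null K) (comp : geometric_complete K).
Implicit Types (a p : K).

Lemma cvg_seq_bounded_norm (u : nat -> K) (l : K) : u @ \oo --> l ->
  exists2 M : K, 0 < M & forall n, `|u n| <= M.
Proof.
move=> /cvgrPdist_lt /(_ 1 ltr01) [N _ HN].
have S0 : 0 <= \sum_(n < N) `|u n| by exact: sumr_ge0.
exists (`|l| + 1 + \sum_(n < N) `|u n|).
  by rewrite ltr_wpDr // ltr_wpDl.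
move=> n; have [nN|Nn] := ltnP n N.
  rewrite (bigD1 (Ordinal nN)) //= addrCA lerDl addr_ge0 ?addr_ge0 //.
  exact: sumr_ge0.
rewrite -[leLHS]addr0 lerD //; have /= /ltW H := HN n Nn.
rewrite -[u n](subKr l); apply: le_trans (ler_normB _ _) _.
by rewrite lerD2l.
Qed.

(** For small a all the partial products stay within 1/2 of 1, which bounds them
away from both infinity and 0. *)
Lemma qpoch_near1 a p n : `|p| < 1 -> `|a| <= (1 - `|p|) / 4%:R ->
  `|qpoch a p n - 1| <= (1 - `|p| ^+ n) / 2%:R.
Proof.
move=> p1 ap; elim: n => [|n IH].
  by rewrite qpoch0 !subrr normr0 mul0r.
have pn0 : 0 <= `|p| ^+ n by rewrite exprn_ge0.
have P2 : `|qpoch a p n| <= 2%:R.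
  rewrite -[qpoch a p n](subrK 1); apply: le_trans (ler_normD _ _) _.
  rewrite normr1 (_ : 2%:R = 1 + 1 :> K) // lerD2r; apply: le_trans IH _.
  rewrite ler_pdivrMr ?ltr0n // mul1r; apply: (@le_trans _ _ 1).
    by rewrite gerBl.
  by rewrite ler1n.
have -> : qpoch a p n.+1 - 1 = (qpoch a p n - 1) - qpoch a p n * (a * p ^+ n).
  by rewrite qpochS; ring.
apply: le_trans (ler_normB _ _) _.
have -> : (1 - `|p| ^+ n.+1) / 2%:R =
    (1 - `|p| ^+ n) / 2%:R + 2%:R * ((1 - `|p|) / 4%:R * `|p| ^+ n) :> K.
  by rewrite exprS; field.
by apply: lerD => //; rewrite !normrM normrX ler_pM ?mulr_ge0 // ler_wpM2r.
Qed.

Lemma cvg_qpoch_small a p : `|p| < 1 -> `|a| <= (1 - `|p|) / 4%:R ->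
  exists2 l : K, l != 0 & qpoch a p @ \oo --> l.
Proof.
move=> p1 ap.
have P1 n : `|qpoch a p n - 1| <= 2%:R^-1.
  apply: le_trans (qpoch_near1 n p1 ap) _.
  by rewrite ler_piMl ?invr_ge0 ?ler0n // gerBl exprn_ge0.
have P2 n : `|qpoch a p n| <= 1 + 2%:R^-1.
  rewrite -[qpoch a p n](subrK 1) addrC; apply: le_trans (ler_normD _ _) _.
  by rewrite normr1 lerD2l.
have : cvgn (qpoch a p).
  apply: (@comp _ ((1 + 2%:R^-1) * `|a|) `|p|) => // n.
  rewrite (_ : _ - _ = - (qpoch a p n * (a * p ^+ n))); last by rewrite qpochS; ring.
  by rewrite normrN !normrM normrX -mulrA ler_wpM2r ?mulr_ge0 ?exprn_ge0.
move=> cP; exists (limn (qpoch a p)) => //; apply/eqP => l0.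
move: cP; rewrite l0 => /cvgrPdist_lt /(_ 2%:R^-1).
rewrite invr_gt0 ltr0n => /(_ isT) [N _ /(_ N (leqnn N))] /=.
rewrite sub0r normrN => H.
have : `|qpoch a p N - (qpoch a p N - 1)| < 2%:R^-1 + 2%:R^-1.
  by apply: le_lt_trans (ler_normB _ _) _; apply: ltr_leD.
by rewrite subKr normr1 (_ : 2%:R^-1 + 2%:R^-1 = 1) ?ltxx //; field.
Qed.

(** The tail of the product starting at a large index M has a parameter a p^M
small enough for the previous lemma. *)
Lemma cvg_qpoch_ex a p : `|p| < 1 -> exists2 l : K,
  qpoch a p @ \oo --> l & (forall n, 1 - a * p ^+ n != 0) -> l != 0.
Proof.
move=> p1; have c0 : 0 < (1 - `|p|) / 4%:R by rewrite divr_gt0 ?ltr0n // subr_gt0.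
have : (fun n => a * p ^+ n) @ \oo --> a * 0.
  by apply: cvgM; [exact: cvg_cst | exact: geo].
rewrite mulr0 => /cvgrPdist_lt /(_ _ c0) [M _ /(_ M (leqnn M))] /=.
rewrite sub0r normrN => /ltW /(cvg_qpoch_small p1) [l l0 lP].
exists (qpoch a p M * l).
  rewrite -(cvg_shiftn M) /=.
  under eq_fun do rewrite addnC qpochD.
  by apply: cvgM => //; exact: cvg_cst.
move=> nz; rewrite mulf_neq0 //; elim: (M) => [|n IH]; first by rewrite qpoch0 oner_neq0.
by rewrite qpochS mulf_neq0.
Qed.

Lemma cvg_qpoch a p : `|p| < 1 -> qpoch a p @ \oo --> qpoch_inf a p.
Proof. by move=> /(cvg_qpoch_ex a) [l lP _]; exact: cvgP lP. Qed.

Lemma qpoch_inf_neq0 a p : `|p| < 1 -> (forall n, 1 - a * p ^+ n != 0) ->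
  qpoch_inf a p != 0.
Proof.
move=> p1 nz; have [l lP /(_ nz) l0] := cvg_qpoch_ex a p1.
by rewrite (_ : qpoch_inf a p = l) //; apply: cvg_lim.
Qed.

End InfiniteProducts.

(** * Completeness of the complex numbers *)

(** Convergence in terms of the norm of K as a numeric field, rather than as a
normed module over itself. *)
Lemma cvg_numP (K : numFieldType) (u : nat -> K) (l : K) :
  (forall e, 0 < e -> exists N, forall n, (N <= n)%N -> `|(l - u n : K)| < e) ->
  u @ \oo --> l.
Proof.
move=> H; apply/cvgrPdist_lt => e /H[N HN].
by exists N.
Qed.

Lemma cvg_expn0 (K : numFieldType) (z : K) :
  (forall e, 0 < e -> exists N, forall n, (N <= n)%N -> `|z| ^+ n < e) ->
  (fun n => z ^+ n) @ \oo --> (0 : K).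
Proof.
move=> H; apply: cvg_numP => e /H[N HN]; exists N => n /HN.
by rewrite sub0r normrN normrX.
Qed.

Section Complex.
Context {R : realType}.
(* R[i] as a numFieldType *)
Local Notation C := (complex_complex__canonical__Num_NumField R).

Lemma complex_posP (e : R[i]) : 0 < e -> exists2 x : R, 0 < x & e = x%:C%C.
Proof.
by case: e => a b; rewrite ltcE /= => /andP[/eqP -> a0]; exists a.
Qed.

Lemma complex_geP (e : R[i]) : 0 <= e -> exists2 x : R, 0 <= x & e = x%:C%C.
Proof.
by case: e => a b; rewrite lecE /= => /andP[/eqP -> a0]; exists a.
Qed.

Lemma normc_ge_Im (z : R[i]) : `|complex.Im z|%:C%C <= `|z|.
Proof.
case: z => x y; rewrite normc_def lecR /= -sqrtr_sqr ler_wsqrtr //.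
by rewrite lerDr sqr_ge0.
Qed.

Lemma normc_le_ReIm (x y : R) : `|(x +i* y)%C| <= (`|x| + `|y|)%:C%C.
Proof.
rewrite normc_def lecR /= -[leRHS]ger0_norm ?addr_ge0 // -sqrtr_sqr ler_wsqrtr //.
rewrite sqrrD !real_normK ?num_real // -addrA lerD2l lerDr.
by rewrite mulrn_wge0 ?mulr_ge0.
Qed.

Lemma geometric_null_complex : geometric_null C.
Proof.
move=> z; have [r r0 zr] := complex_geP (normr_ge0 z);
  rewrite zr -[1]/(1%:C%C) ltcR => r1.
apply: cvg_expn0 => _ /complex_posP[e e0 ->].
have : (fun n => r ^+ n) @ \oo --> 0 by apply: cvg_expr; rewrite ger0_norm.
move=> /cvgrPdist_lt /(_ e e0) [N _ HN]; exists N => n /HN /=.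
rewrite sub0r normrN ger0_norm ?exprn_ge0 // => H.
by rewrite zr -rmorphXn ltcR.
Qed.

Lemma real_geometric_cvg (u : nat -> R) (c r : R) : 0 <= r -> r < 1 ->
  (forall n, `|u n.+1 - u n| <= c * r ^+ n) -> cvgn u.
Proof.
move=> r0 r1 ucr.
have : cvgn (series (telescope u)).
  apply: normed_cvg; apply: (@series_le_cvg _ _ (geometric c r)) => //.
  - by move=> n; exact: normr_ge0.
  - by move=> n; exact: le_trans (normr_ge0 _) (ucr n).
  - by apply: is_cvg_geometric_series; rewrite ger0_norm.
rewrite telescopeK => /cvg_ex[l ul]; apply/cvg_ex; exists (l + u 0%N).
have : (fun n => (u n - u 0%N) + u 0%N) @ \oo --> l + u 0%N.
  by apply: cvgD => //; exact: cvg_cst.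
by under eq_fun do rewrite subrK.
Qed.

Lemma geometric_complete_complex : geometric_complete C.
Proof.
move=> u c' r' /complex_geP[r r0 ->]; rewrite -[1]/(1%:C%C) ltcR => r1 H.
have : 0 <= c' by have := le_trans (normr_ge0 _) (H 0%N); rewrite expr0 mulr1.
move=> /complex_geP[c _ c'E]; move: H; rewrite c'E => H.
have cvgRe : cvgn (fun n => complex.Re (u n)).
  apply: (real_geometric_cvg r0 r1 (c := c)) => n; rewrite -raddfB.
  rewrite -lecR; apply: le_trans (normc_ge_Re _) _.
  by rewrite rmorphM rmorphXn; exact: H.
have cvgIm : cvgn (fun n => complex.Im (u n)).
  apply: (real_geometric_cvg r0 r1 (c := c)) => n; rewrite -raddfB.
  rewrite -lecR; apply: le_trans (normc_ge_Im _) _.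
  by rewrite rmorphM rmorphXn; exact: H.
move: cvgRe cvgIm => /cvg_ex[a /cvgrPdist_lt Ha] /cvg_ex[b /cvgrPdist_lt Hb].
apply/cvg_ex; exists (a +i* b)%C; apply: cvg_numP => _ /complex_posP[e e0 ->].
have e2 : 0 < e / 2%:R by rewrite divr_gt0 ?ltr0n.
have [N _ HN] := Ha _ e2; have [M _ HM] := Hb _ e2.
exists (maxn N M) => n; rewrite geq_max => /andP[/HN /= H1 /HM /= H2].
case: (u n) H1 H2 => x y /= H1 H2.
apply: le_lt_trans (normc_le_ReIm (a - x) (b - y)) _.
by rewrite ltcR (splitr e) ltrD.
Qed.
End Complex.

(** * Triple products as limits of Bailey sums *)

Lemma cvg_double (K : numFieldType) (u : nat -> K) (l : K) :
  u @ \oo --> l -> (fun n => u (2 * n)%N) @ \oo --> l.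
Proof.
move=> ul A /ul[N _ HN]; exists N => // n /= Nn; apply: HN => /=.
by rewrite (leq_trans Nn) // mul2n -addnn leq_addr.
Qed.

Section ThetaLimit.
Context {K : numFieldType}.
Context (geo : geometric_null K) (comp : geometric_complete K).
Implicit Types (q p z rho : K) (s r : int) (t n m b N : nat).

Lemma expn_neq1 q n : `|q| < 1 -> q ^+ n.+1 != 1.
Proof.
move=> q1; apply/eqP => /(congr1 Num.norm); rewrite normrX normr1 => /eqP.
by rewrite lt_eqF // exprn_ilt1 ?normr_ge0.
Qed.

(** In the annulus |p| < |z| < 1, theta series are dominated by a geometric
series in |s|. *)
Lemma norm_theta_term_le z p rho s : z != 0 -> p != 0 -> rho < 1 ->
  `|z| <= rho -> `|p / z| <= rho -> `|theta_term z p s| <= rho ^+ `|s|.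
Proof.
move=> z0 p0 rho1 zrho pzrho.
have rho0 : 0 <= rho by exact: le_trans (normr_ge0 _) zrho.
have p1 : `|p| <= 1.
  rewrite -(divfK z0 p) normrM -[1]mulr1.
  by apply: ler_pM => //; [apply: le_trans pzrho _ | apply: le_trans zrho _]; exact: ltW.
have pos y n : `|y| <= rho -> `|theta_term y p n| <= rho ^+ n.
  move=> yrho; rewrite /theta_term normrM -[leRHS]mulr1 -exprnP !normrX.
  by apply: ler_pM; rewrite ?exprn_ge0 ?lerXn2r ?exprn_ile1.
case: s => n; first exact: pos.
by rewrite NegzE theta_term_opp // abszN; exact: pos.
Qed.

Section Base.
Context (q : K) (q1 : `|q| < 1).

Lemma qpoch_inf_base_neq0 : qpoch_inf q q != 0.
Proof.
apply: qpoch_inf_neq0 => // n; rewrite -exprS subr_eq0 eq_sym; exact: expn_neq1.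
Qed.

Lemma cvg_iqpoch (c : int) :
  (fun N : nat => iqpoch q (N%:Z + c)) @ \oo --> (qpoch_inf q q)^-1.
Proof.
have H : (fun N : nat => (qpoch q q N)^-1) @ \oo --> (qpoch_inf q q)^-1.
  by apply: cvgV; [exact: qpoch_inf_base_neq0 | exact: cvg_qpoch].
case: c => m.
  have : (fun N : nat => (qpoch q q (N + m))^-1) @ \oo --> (qpoch_inf q q)^-1.
    by rewrite (cvg_shiftn m (fun N => (qpoch q q N)^-1)).
  by [].
rewrite -(cvg_shiftn m.+1) /=.
rewrite (_ : (fun _ => _) = (fun N : nat => (qpoch q q N)^-1)) //.
apply/funext => n; rewrite -[RHS]/(iqpoch q n); congr iqpoch; lia.
Qed.

Lemma qpoch_bounds : exists2 M : K, 0 < M &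
  (forall n, `|qpoch q q n| <= M) /\ (forall k, `|iqpoch q k| <= M).
Proof.
have [M M0 HM] := cvg_seq_bounded_norm (@cvg_qpoch _ geo comp q q q1).
have [M' M'0 HM'] := cvg_seq_bounded_norm (@cvg_iqpoch 0).
exists (M + M'); first exact: addr_gt0.
split=> [n|[n|n]].
- by apply: le_trans (HM n) _; rewrite lerDl ltW.
- by have := HM' n; rewrite addr0 => /le_trans; apply; rewrite lerDr ltW.
- by rewrite iqpoch_neg // normr0 addr_ge0 ?ltW.
Qed.

End Base.

Lemma prod4_norm_le (a b c d A B : K) : `|a| <= A -> `|b| <= B -> `|c| <= B ->
  `|d| <= B -> `|a * (b * (c * d))| <= A * (B * (B * B)).
Proof. by move=> *; rewrite !normrM; do 3![apply: ler_pM; rewrite ?mulr_ge0 //]. Qed.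

(** The theta series is the limit of two finite sums: the finite triple product,
which gives its value, and the Bailey sum with its normalising factor.  Both
are dominated by the same kind of geometric family. *)
Lemma theta_limit q p z rho t b : 0 < `|q| -> `|q| < 1 -> (0 < t)%N ->
  z != 0 -> p != 0 -> rho < 1 -> `|z| <= rho -> `|p / z| <= rho ->
  (fun N => qpoch q q N * bsum q t (theta_term (- z) p) N b) @ \oo -->
    qpochs_inf [:: z; p / z; p] p / qpoch_inf q q.
Proof.
rewrite normr_gt0 => q0 q1 t0 z0 p0 rho1 zrho pzrho.
have rho0 : 0 <= rho by exact: le_trans (normr_ge0 _) zrho.
have p1 : `|p| < 1.
  rewrite -(divfK z0 p) normrM -[1]mulr1;
    apply: le_lt_trans (ler_pM _ _ pzrho zrho) _ => //.
  by rewrite mulr1 mulr_ilt1.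
have th s : `|theta_term (- z) p s| <= rho ^+ `|s|.
  by apply: norm_theta_term_le; rewrite ?oppr_eq0 ?normrN // invrN mulrN normrN.
have rhoT : tail_small (fun s : int => rho ^+ `|s|).
  by apply: tail_small_zrange => //; apply: geo; rewrite ger0_norm.
have Qinf := qpoch_inf_base_neq0 q1.
have Pinf := qpoch_inf_base_neq0 p1.
have [Mq Mq0 [Hq1 Hq2]] := qpoch_bounds q1.
have [Mp Mp0 [Hp1 Hp2]] := qpoch_bounds p1.
(* Both f and f' tend to the theta term; f sums to a finite triple product. *)
pose f M s := theta_term (- z) p s * (qpoch p p (2 * M) * (qpoch p p M *
   (iqpoch p (M%:Z - s) * iqpoch p (M%:Z + s)))).
pose f' N s := theta_term (- z) p s * (qpoch q q N * qpoch_inf q q *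
   (iqpoch q (N%:Z - t%:Z * s) * iqpoch q (N%:Z + b%:Z + t%:Z * s))).
have p1' := fun n => expn_neq1 n p1.
have lim : (fun M => \sum_(s <- zrange M) f M s) @ \oo --> qpochs_inf [:: z; p / z; p] p.
  have E M : \sum_(s <- zrange M) f M s =
      qpoch z p M * (qpoch (p / z) p M * (qpoch p p M * 1)).
    transitivity (qpoch p p M * (bsum p 1 (theta_term (- z) p) M 0 * qpoch p p (2 * M))).
      rewrite sum_zrange /bsum addn0 mulrA mulrAC -zsum_scale; apply: eq_zsum => s.
      by rewrite /f /bterm mul1r addr0; ring.
    by rewrite (finite_triple_product p0 p1') //; ring.
  under eq_fun do rewrite E.
  rewrite /qpochs_inf !big_cons big_nil.
  by do 3![apply: cvgM; first exact: cvg_qpoch]; exact: cvg_cst.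
have ff s : f ^~ s @ \oo --> theta_term (- z) p s.
  have -> : theta_term (- z) p s = theta_term (- z) p s * (qpoch_inf p p *
      (qpoch_inf p p * ((qpoch_inf p p)^-1 * (qpoch_inf p p)^-1))) by field.
  apply: cvgM; first exact: cvg_cst.
  apply: cvgM; first by apply: cvg_double; exact: cvg_qpoch.
  apply: cvgM; first exact: cvg_qpoch.
  by apply: cvgM; exact: cvg_iqpoch.
have ff' s : f' ^~ s @ \oo --> theta_term (- z) p s.
  have -> : theta_term (- z) p s = theta_term (- z) p s * (qpoch_inf q q *
      qpoch_inf q q * ((qpoch_inf q q)^-1 * (qpoch_inf q q)^-1)) by field.
  apply: cvgM; first exact: cvg_cst.
  apply: cvgM; first by apply: cvgM; [exact: cvg_qpoch | exact: cvg_cst].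
  apply: cvgM; first exact: cvg_iqpoch.
  by under eq_fun do rewrite -addrA; exact: cvg_iqpoch.
have nf N s : `|f N s| <= (Mp * (Mp * (Mp * Mp))) * rho ^+ `|s|.
  by rewrite mulrC normrM; apply: ler_pM => //; exact: prod4_norm_le.
have nf' N s : `|f' N s| <= (Mq * `|qpoch_inf q q| * (Mq * Mq)) * rho ^+ `|s|.
  rewrite mulrC normrM; apply: ler_pM => //; rewrite !normrM.
  by do 2?[apply: ler_pM; rewrite ?mulr_ge0 //].
have tail c : 0 <= c -> tail_small (fun s : int => c * rho ^+ `|s|).
  by move=> c0; apply: tail_small_scale => // s; exact: exprn_ge0.
have lim' : (fun N => \sum_(s <- zrange (N + b)) f' N s) @ \oo --> qpochs_inf [:: z;
  p / z; p] p.
  apply: (tannery_transfer _ _ _ _ _ _ nf nf' ff ff' lim).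
  - by apply: tail; rewrite !mulr_ge0 // ltW.
  - by apply: tail; rewrite !mulr_ge0 // ltW.
  - exact: zrange_uniq.
  - by move=> N; exact: zrange_uniq.
  - move=> N s; rewrite mem_zrange -ltnNge -[N in X in (X < _)%N]addn0 => Ns.
    have := bterm_supported p (theta_term (- z) p) (ltn0Sn 0) Ns.
    rewrite /bterm /f mul1r addr0; move: (iqpoch p _ * _) => X H.
    by rewrite mulrCA [theta_term _ _ _ * (_ * X)]mulrCA H !mulr0.
  - move=> N s; rewrite mem_zrange -ltnNge => Ns.
    have := bterm_supported q (theta_term (- z) p) t0 Ns.
    by rewrite /bterm /f' => H; rewrite mulrCA H mulr0.
have -> : (fun N => qpoch q q N * bsum q t (theta_term (- z) p) N b) =
  (fun N => (\sum_(s <- zrange (N + b)) f' N s) * (qpoch_inf q q)^-1).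
  apply/funext => N; rewrite sum_zrange /bsum -zsum_scale mulrC -zsum_scale.
  by apply: eq_zsum => s; rewrite /f' /bterm; field.
by apply: cvgM => //; exact: cvg_cst.
Qed.

End ThetaLimit.

(** * The triple series as a limit *)

Lemma leq_expo a b c i j k : (i + j + k <= expo a b c i j k)%N.
Proof.
have h n : (n <= n * n)%N by case: n => // n; rewrite leq_pmulr.
apply: (@leq_trans (i * i + 2 * j * j + k * k)).
  by move: (h i) (h j) (h k); rewrite -mulnA; lia.
by rewrite /expo -!addnA !leq_add2l leq_addr.
Qed.

Section TripleLimit.
Context {K : numFieldType}.
Context (geo : geometric_null K) (comp : geometric_complete K).

Lemma big_ord_parity (F : nat -> K) n :
  \sum_(i < 2 * n) F i = \sum_(m < n) F (2 * m + 0)%N + \sum_(m < n) F (2 * m + 1)%N.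
Proof.
elim: n => [|n IH]; first by rewrite !big_ord0 addr0.
by rewrite mulnS !addSn add0n !big_ord_recr /= IH addn0 addn1; ring.
Qed.

Context (q : K) (q0 : 0 < `|q|) (q1 : `|q| < 1).
Local Notation Q := (q ^+ 2).

Lemma norm_sqr_lt1 : `|Q| < 1.
Proof. by rewrite normrX exprn_ilt1. Qed.

Lemma norm_trunc_term_le a b c : exists2 M : K, 0 < M & forall N i j k,
  `|trunc_term q a b c N i j k| <= M * `|q| ^+ (i + j + k).
Proof.
have [M M0 [_ HM]] := qpoch_bounds geo comp q1.
have [L L0 [HL HL']] := qpoch_bounds geo comp norm_sqr_lt1.
exists (M * L * L * (L * L) * (L * L)); first by rewrite !mulr_gt0.
move=> N i j k; rewrite [leRHS]mulrC /trunc_term -!mulrA normrM.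
apply: ler_pM => //.
  by rewrite normrX; apply: ler_wiXn2l; rewrite ?normr_ge0 ?ltW // leq_expo.
by rewrite !normrM; do 8?[apply: ler_pM; rewrite ?mulr_ge0 //].
Qed.

Lemma cvg_trunc_term a b c i j k :
  (fun N => trunc_term q a b c N i j k) @ \oo -->
    q ^+ expo a b c i j k / (qpoch q q i * qpoch Q Q j * qpoch Q Q k).
Proof.
have Q1 := norm_sqr_lt1.
have Qinf := qpoch_inf_base_neq0 geo comp Q1.
have lim (m : nat) (r : int) :
    (fun N : nat => qpoch Q Q (N - m) * iqpoch Q (N%:Z + r)) @ \oo --> (1 : K).
  rewrite -(mulfV Qinf); apply: cvgM; last exact: cvg_iqpoch.
  rewrite -(cvg_shiftn m) /=; under eq_fun do rewrite addnK.
  exact: cvg_qpoch.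
rewrite -[X in _ --> X](_ : q ^+ expo a b c i j k * (iqpoch q i * iqpoch Q j * iqpoch
  Q k) * 1 * 1 = _).
  2: by rewrite !mulr1 /iqpoch !invfM.
apply: cvgM; last first.
  by under eq_fun => N do rewrite -[N%:Z - _ - _]addrA -{1}[N]subn0; exact: lim.
apply: cvgM; first exact: cvg_cst.
by under eq_fun => N do rewrite -[N%:Z - _ - _]addrA; exact: lim.
Qed.

(** The truncated double series that comes from the indices i of parity e, up to
a power of q. *)
Definition bailey_sum (a b c e N : nat) : K :=
  qpoch Q Q N * qpoch (- q ^+ (1 + e + c)) Q N * double_bailey q (e + a) (e + b)
    (fun m => iqpoch q (2 * m + e)%N / qpoch (- q ^+ (1 + e + c)) Q m) N.

(** The triple series is the sum of the contributions of even and odd i. *)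
Lemma triple_has_sum a b c (l0 l1 : K) :
  bailey_sum a b c 0 @ \oo --> l0 -> bailey_sum a b c 1 @ \oo --> l1 ->
  has_sum3 (fun i j k => q ^+ expo a b c i j k
      / (qpoch q q i * qpoch Q Q j * qpoch Q Q k))
    (l0 + q ^+ (1 + a + b) * l1).
Proof.
move=> H0 H1; have [M M0 HM] := norm_trunc_term_le a b c.
apply: (@tannery_has_sum _ _ (fun N t => trunc_term q a b c N t.1.1 t.1.2 t.2) _
   (fun t => M * `|q| ^+ (t.1.1 + t.1.2 + t.2))
   (fun N => box (2 * N.+1) N.+1 N.+1)).
- apply: tail_small_scale; [exact: ltW | by move=> t; exact: exprn_ge0 |].
  by apply: tail_small_box => //; apply: geo; rewrite normr_id.
- by move=> N; exact: box_uniq.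
- move=> N [[i j] k] /=; rewrite mem_box !negb_and -!leqNgt => /or3P out.
  rewrite /trunc_term; case: out => out.
  + by rewrite [iqpoch Q (_ - k%:Z)]iqpoch_neg ?(mul0r, mulr0) //; lia.
  + by rewrite [iqpoch Q (_ - j%:Z)]iqpoch_neg ?(mul0r, mulr0) //; lia.
  + by rewrite [iqpoch Q (_ - k%:Z)]iqpoch_neg ?(mul0r, mulr0) //; lia.
- by move=> N t; exact: HM.
- by move=> t; exact: cvg_trunc_term.
have E N : \sum_(t <- box (2 * N.+1) N.+1 N.+1) trunc_term q a b c N t.1.1 t.1.2 t.2
    = bailey_sum a b c 0 N + q ^+ (1 + a + b) * bailey_sum a b c 1 N.
  rewrite sum_box /=.
  rewrite (big_ord_parity (fun i : nat => \sum_(j < N.+1) \sum_(k < N.+1) trunc_term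
    q a b c N i j k)).
  have q0' : q != 0 by rewrite -normr_gt0.
  rewrite !trunc_sum // => *; try exact: expn_neq1.
  by rewrite mul0n mul1n expr0 mul1r.
under eq_fun do rewrite E.
by apply: cvgD => //; apply: cvgM => //; exact: cvg_cst.
Qed.

End TripleLimit.

(** * Identities between infinite products *)

Section Products.
Context {K : numFieldType}.
Context (geo : geometric_null K) (comp : geometric_complete K).
Implicit Types (a p : K).

Lemma qpoch_inf_mulN a p : `|p| < 1 ->
  qpoch_inf a p * qpoch_inf (- a) p = qpoch_inf (a ^+ 2) (p ^+ 2).
Proof.
move=> p1; have pp1 : `|p ^+ 2| < 1 by rewrite normrX exprn_ilt1.
have E n : qpoch a p n * qpoch (- a) p n = qpoch (a ^+ 2) (p ^+ 2) n.
  elim: n => [|n IH]; first by rewrite !qpoch0 mulr1.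
  by rewrite !qpochS -IH exprAC; ring.
have H : (fun n => qpoch a p n * qpoch (- a) p n) @ \oo --> qpoch_inf a p * qpoch_inf
  (- a) p.
  by apply: cvgM; exact: cvg_qpoch.
apply/esym; apply: cvg_lim => //.
by move: H; under eq_fun do rewrite E.
Qed.

Lemma qpoch_inf_split a p : `|p| < 1 ->
  qpoch_inf a p = qpoch_inf a (p ^+ 2) * qpoch_inf (a * p) (p ^+ 2).
Proof.
move=> p1; have pp1 : `|p ^+ 2| < 1 by rewrite normrX exprn_ilt1.
have E n : qpoch a p (2 * n) = qpoch a (p ^+ 2) n * qpoch (a * p) (p ^+ 2) n.
  elim: n => [|n IH]; first by rewrite muln0 !qpoch0 mulr1.
  by rewrite mulnS !addSn add0n !qpochS IH (exprS p (2 * n)) !(exprM p 2); ring.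
have H : (fun n => qpoch a (p ^+ 2) n * qpoch (a * p) (p ^+ 2) n) @ \oo -->
    qpoch_inf a (p ^+ 2) * qpoch_inf (a * p) (p ^+ 2).
  by apply: cvgM; exact: cvg_qpoch.
have H' := cvg_double (@cvg_qpoch _ geo comp a p p1).
apply: (cvg_unique _ H') => //; move: H.
by under [in X in X -> _]eq_fun do rewrite -E.
Qed.

Lemma qpoch_infSl a p : `|p| < 1 -> qpoch_inf a p = (1 - a) * qpoch_inf (a * p) p.
Proof.
move=> p1; have H : (fun n => (1 - a) * qpoch (a * p) p n) @ \oo --> (1 - a) *
  qpoch_inf (a * p) p.
  by apply: cvgM; [exact: cvg_cst | exact: cvg_qpoch].
apply: cvg_lim => //; rewrite -(cvg_shiftn 1) /=.
by under eq_fun do rewrite addn1 qpochSl.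
Qed.

Lemma qpochs_inf3 (a b c p : K) :
  qpochs_inf [:: a; b; c] p = qpoch_inf a p * qpoch_inf b p * qpoch_inf c p.
Proof. by rewrite /qpochs_inf !big_cons big_nil mulr1 mulrA. Qed.

Lemma qpochs_inf_swap (a b c p : K) :
  qpochs_inf [:: a; b; c] p = qpochs_inf [:: b; a; c] p.
Proof. by rewrite !qpochs_inf3; ring. Qed.

Context (q : K) (q1 : `|q| < 1).
Local Notation Q := (q ^+ 2).

Lemma product_134 :
  qpoch_inf (- q) Q * qpochs_inf [:: q; q ^+ 3; q ^+ 4] (q ^+ 4) = qpoch_inf Q Q.
Proof.
have Q1 := norm_sqr_lt1 q1.
rewrite qpochs_inf3 (qpoch_inf_split Q Q1) -(qpoch_inf_mulN q Q1).
rewrite (qpoch_inf_split q Q1) -exprS -exprD -exprM; ring.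
Qed.

Lemma product_224 :
  qpoch_inf (- Q) Q * qpochs_inf [:: q ^+ 2; q ^+ 2; q ^+ 4] (q ^+ 4) = qpoch_inf Q Q.
Proof.
have Q1 := norm_sqr_lt1 q1.
have := qpoch_inf_mulN Q Q1; have E := qpoch_inf_split Q Q1.
rewrite qpochs_inf3 E -exprD -exprM => H.
by rewrite -[in RHS]H; ring.
Qed.

End Products.

(** * The four identities *)

Section FourIdentities.
Context {K : numFieldType}.
Context (geo : geometric_null K) (comp : geometric_complete K).

Lemma eq_has_sum3 (x y : nat -> nat -> nat -> K) (l m : K) :
  (forall i j k, x i j k = y i j k) -> l = m -> has_sum3 x l -> has_sum3 y m.
Proof.
move=> xy <-; rewrite (_ : x = y) //.
by apply/funext => i; apply/funext => j; apply/funext => k.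
Qed.

Section NonZero.
Context (q : K) (q0 : q != 0) (q1 : `|q| < 1).
Local Notation Q := (q ^+ 2).

(** The factor y absorbs a constant that appears in the double sum when e = c = 1,
and P is one of the two denominators of the theorem. *)
Lemma bailey_sum_cvg a b c e t m (x y z w p P : K) :
  (forall N, double_bailey q (e + a) (e + b)
    (fun m => iqpoch q (2 * m + e)%N / qpoch (- q ^+ (1 + e + c)) Q m) N
    = y * bsum Q t (theta_term x p) N m) ->
  y * qpoch_inf (- q ^+ (1 + e + c)) Q * P = qpoch_inf Q Q ->
  (0 < t)%N -> x = - z -> p = z * w -> p != 0 -> `|z| <= `|q| -> `|w| <= `|q| ->
  bailey_sum q a b c e @ \oo --> qpochs_inf [:: w; z; p] p / P.
Proof.
move=> + yP t0 xz pzw p0 zq wq; rewrite xz => ev.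
have z0 : z != 0 by apply: contraNneq p0 => z0; rewrite pzw z0 mul0r.
have pz : p / z = w by rewrite pzw mulrAC divff ?mul1r.
have Q1 := norm_sqr_lt1 q1.
have QQ : qpoch_inf Q Q != 0 by exact: qpoch_inf_base_neq0.
have P0 : P != 0 by apply: contraNneq QQ => P0; rewrite -yP P0 mulr0.
have Q0 : 0 < `|Q| by rewrite normr_gt0 expf_neq0.
have pzq : `|p / z| <= `|q| by rewrite pz.
have H : (fun N => y * (qpoch (- q ^+ (1 + e + c)) Q N *
     (qpoch Q Q N * bsum Q t (theta_term (- z) p) N m))) @ \oo -->
  y * (qpoch_inf (- q ^+ (1 + e + c)) Q * (qpochs_inf [:: z; p / z;
    p] p / qpoch_inf Q Q)).
  apply: cvgM; first exact: cvg_cst.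
  by apply: cvgM; [exact: cvg_qpoch | exact: (theta_limit geo comp m Q0 Q1 t0 z0 p0
    q1 zq pzq)].
have -> : qpochs_inf [:: w; z; p] p / P = y * (qpoch_inf (- q ^+ (1 + e + c)) Q *
    (qpochs_inf [:: z; p / z; p] p / qpoch_inf Q Q)).
  rewrite pz qpochs_inf_swap; apply: (mulIf P0); rewrite divfK //.
  rewrite -[LHS](mulfK QQ) -{1}yP; ring.
have -> : bailey_sum q a b c e = (fun N => y * (qpoch (- q ^+ (1 + e + c)) Q N *
     (qpoch Q Q N * bsum Q t (theta_term (- z) p) N m))).
  by apply/funext => N; rewrite /bailey_sum ev; ring.
exact: H.
Qed.

Lemma norm_expn_le n : `|q ^+ n.+1| <= `|q|.
Proof. by rewrite normrX exprS ler_piMr // exprn_ile1 //; exact: ltW. Qed.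

Let q1' n : q ^+ n.+1 != 1. Proof. exact: expn_neq1. Qed.

(** The infinite product (- q; Q) has first factor 1 + q. *)
Lemma product_134_shift :
  (1 + q) * qpoch_inf (- q ^+ 3) Q * qpochs_inf [:: q; q ^+ 3; q ^+ 4] (q ^+ 4)
  = qpoch_inf Q Q.
Proof.
rewrite -(product_134 geo comp q1) (qpoch_infSl geo comp (- q) (norm_sqr_lt1 q1)).
by rewrite opprK mulNr -exprS.
Qed.

Local Notation D134 := (qpochs_inf [:: q; q ^+ 3; q ^+ 4] (q ^+ 4)).
Local Notation D224 := (qpochs_inf [:: q ^+ 2; q ^+ 2; q ^+ 4] (q ^+ 4)).

Lemma limit_000_even : bailey_sum q 0 0 0 0 @ \oo -->
  qpochs_inf [:: q ^+ 20; q ^+ 24; q ^+ 44] (q ^+ 44) / D134.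
Proof.
apply: (@bailey_sum_cvg 0 0 0 0 2 0 _ 1).
- by move=> N; rewrite mul1r; exact: eval_000_even.
- by rewrite mul1r; exact: product_134.
- by [].
- by [].
- by rewrite -exprD.
- exact: expf_neq0.
- exact: norm_expn_le.
- exact: norm_expn_le.
Qed.

Lemma limit_000_odd : bailey_sum q 0 0 0 1 @ \oo -->
  qpochs_inf [:: - q; q ^+ 10; - q ^+ 11] (- q ^+ 11) / D224.
Proof.
apply: (@bailey_sum_cvg 0 0 0 1 1 1 _ 1).
- by move=> N; rewrite mul1r; exact: eval_000_odd.
- by rewrite mul1r; exact: product_224.
- by [].
- by [].
- by rewrite mulrN -exprSr.
- by rewrite oppr_eq0 expf_neq0.
- exact: norm_expn_le.
- by rewrite normrN.
Qed.

Lemma limit_001_even : bailey_sum q 0 0 1 0 @ \oo -->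
  qpochs_inf [:: - q ^+ 5; q ^+ 6; - q ^+ 11] (- q ^+ 11) / D224.
Proof.
rewrite qpochs_inf_swap; apply: (@bailey_sum_cvg 0 0 1 0 1 0 _ 1).
- by move=> N; rewrite mul1r; exact: eval_001_even.
- by rewrite mul1r; exact: product_224.
- by [].
- by rewrite opprK.
- by rewrite mulNr -exprD.
- by rewrite oppr_eq0 expf_neq0.
- by rewrite normrN norm_expn_le.
- exact: norm_expn_le.
Qed.

Lemma limit_001_odd : bailey_sum q 0 0 1 1 @ \oo -->
  qpochs_inf [:: q ^+ 12; q ^+ 32; q ^+ 44] (q ^+ 44) / D134.
Proof.
apply: (@bailey_sum_cvg 0 0 1 1 2 1 _ (1 + q)).
- by move=> N; exact: eval_001_odd.
- exact: product_134_shift.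
- by [].
- by [].
- by rewrite -exprD.
- exact: expf_neq0.
- exact: norm_expn_le.
- exact: norm_expn_le.
Qed.

Lemma limit_011_even : bailey_sum q 0 1 1 0 @ \oo -->
  qpochs_inf [:: q ^+ 4; - q ^+ 7; - q ^+ 11] (- q ^+ 11) / D224.
Proof.
apply: (@bailey_sum_cvg 0 1 1 0 1 0 _ 1).
- by move=> N; rewrite mul1r; exact: eval_011_even.
- by rewrite mul1r; exact: product_224.
- by [].
- by rewrite opprK.
- by rewrite mulNr -exprD.
- by rewrite oppr_eq0 expf_neq0.
- by rewrite normrN norm_expn_le.
- exact: norm_expn_le.
Qed.

Lemma limit_011_odd : bailey_sum q 0 1 1 1 @ \oo -->
  qpochs_inf [:: q ^+ 8; q ^+ 36; q ^+ 44] (q ^+ 44) / D134.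
Proof.
apply: (@bailey_sum_cvg 0 1 1 1 2 1 _ (1 + q)).
- by move=> N; exact: eval_011_odd.
- exact: product_134_shift.
- by [].
- by [].
- by rewrite -exprD.
- exact: expf_neq0.
- exact: norm_expn_le.
- exact: norm_expn_le.
Qed.

Lemma limit_111_even : bailey_sum q 1 1 1 0 @ \oo -->
  qpochs_inf [:: q ^+ 2; - q ^+ 9; - q ^+ 11] (- q ^+ 11) / D224.
Proof.
apply: (@bailey_sum_cvg 1 1 1 0 1 1 _ 1).
- by move=> N; rewrite mul1r; exact: eval_111_even.
- by rewrite mul1r; exact: product_224.
- by [].
- by rewrite opprK.
- by rewrite mulNr -exprD.
- by rewrite oppr_eq0 expf_neq0.
- by rewrite normrN norm_expn_le.
- exact: norm_expn_le.
Qed.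

Lemma limit_111_odd : bailey_sum q 1 1 1 1 @ \oo -->
  qpochs_inf [:: q ^+ 4; q ^+ 40; q ^+ 44] (q ^+ 44) / D134.
Proof.
apply: (@bailey_sum_cvg 1 1 1 1 2 2 _ (1 + q)).
- by move=> N; exact: eval_111_odd.
- exact: product_134_shift.
- by [].
- by [].
- by rewrite -exprD.
- exact: expf_neq0.
- exact: norm_expn_le.
- exact: norm_expn_le.
Qed.

End NonZero.

(** For q = 0 only the term i = j = k = 0 survives. *)
Lemma has_sum3_zero a b c :
  has_sum3 (fun i j k => (0 : K) ^+ expo a b c i j k
     / (qpoch 0 0 i * qpoch 0 0 j * qpoch 0 0 k)) 1.
Proof.
pose F (t : nat * nat * nat) : K := (0 : K) ^+ expo a b c t.1.1 t.1.2 t.2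
     / (qpoch 0 0 t.1.1 * qpoch 0 0 t.1.2 * qpoch 0 0 t.2).
have F0 t : t != (0, 0, 0)%N -> F t = 0.
  case: t => [[i j] k] ijk; rewrite /F [t in t / _](_ : _ = 0) ?mul0r //=.
  have ijk0 : (0 < i + j + k)%N by case: i j k ijk => [|i] [|j] [|k].
  by rewrite expr0n eqn0Ngt (leq_trans ijk0 (leq_expo a b c i j k)).
have F1 : F (0, 0, 0)%N = 1.
  by rewrite /F /= !qpoch0 /expo !(muln0, mul0n, addn0) expr0 !mulr1 divr1.
apply: (@tannery_has_sum _ _ (fun N t => F t) F (fun t => `|F t|) (fun=> [:: (0, 0,
  0)%N])) => //.
- move=> eps eps0; exists [:: (0, 0, 0)%N] => A _ HA.
  rewrite big_seq big1 // => t /HA; rewrite inE => /F0 ->; exact: normr0.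
- by move=> _ t; rewrite inE => /F0.
- by move=> t; exact: cvg_cst.
- by under eq_fun do rewrite big_seq1 F1; exact: cvg_cst.
Qed.

Lemma qpochs_inf_zero (s : seq K) p : all (pred1 0) s -> qpochs_inf s p = 1.
Proof.
move=> /allP s0; rewrite /qpochs_inf big_seq big1 // => a /s0 /eqP ->.
apply: cvg_lim => //; rewrite (_ : qpoch 0 p = fun=> 1); first exact: cvg_cst.
by apply/funext => n; rewrite /qpoch big1 // => i _; rewrite mul0r subr0.
Qed.

(** The four identities over any field with these two convergence properties. *)
Theorem four_identities (q : K) (hq : `|q| < 1) :
  [/\ has_sum3
        (fun i j k => q ^+ expo 0 0 0 i j k
           / (qpoch q q i * qpoch (q ^+ 2) (q ^+ 2) j
              * qpoch (q ^+ 2) (q ^+ 2) k))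
        (qpochs_inf [:: q ^+ 20; q ^+ 24; q ^+ 44] (q ^+ 44)
           / qpochs_inf [:: q; q ^+ 3; q ^+ 4] (q ^+ 4)
         + q * (qpochs_inf [:: - q; q ^+ 10; - q ^+ 11] (- q ^+ 11)
                / qpochs_inf [:: q ^+ 2; q ^+ 2; q ^+ 4] (q ^+ 4))),
      has_sum3
        (fun i j k => q ^+ expo 0 0 1 i j k
           / (qpoch q q i * qpoch (q ^+ 2) (q ^+ 2) j
              * qpoch (q ^+ 2) (q ^+ 2) k))
        (qpochs_inf [:: - q ^+ 5; q ^+ 6; - q ^+ 11] (- q ^+ 11)
           / qpochs_inf [:: q ^+ 2; q ^+ 2; q ^+ 4] (q ^+ 4)
         + q * (qpochs_inf [:: q ^+ 12; q ^+ 32; q ^+ 44] (q ^+ 44)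
                / qpochs_inf [:: q; q ^+ 3; q ^+ 4] (q ^+ 4))),
      has_sum3
        (fun i j k => q ^+ expo 0 1 1 i j k
           / (qpoch q q i * qpoch (q ^+ 2) (q ^+ 2) j
              * qpoch (q ^+ 2) (q ^+ 2) k))
        (qpochs_inf [:: q ^+ 4; - q ^+ 7; - q ^+ 11] (- q ^+ 11)
           / qpochs_inf [:: q ^+ 2; q ^+ 2; q ^+ 4] (q ^+ 4)
         + q ^+ 2 * (qpochs_inf [:: q ^+ 8; q ^+ 36; q ^+ 44] (q ^+ 44)
                     / qpochs_inf [:: q; q ^+ 3; q ^+ 4] (q ^+ 4)))
    & has_sum3
        (fun i j k => q ^+ expo 1 1 1 i j k
           / (qpoch q q i * qpoch (q ^+ 2) (q ^+ 2) j
              * qpoch (q ^+ 2) (q ^+ 2) k))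
        (qpochs_inf [:: q ^+ 2; - q ^+ 9; - q ^+ 11] (- q ^+ 11)
           / qpochs_inf [:: q ^+ 2; q ^+ 2; q ^+ 4] (q ^+ 4)
         + q ^+ 3 * (qpochs_inf [:: q ^+ 4; q ^+ 40; q ^+ 44] (q ^+ 44)
                     / qpochs_inf [:: q; q ^+ 3; q ^+ 4] (q ^+ 4)))].
Proof.
have [->|q0] := eqVneq q 0.
  have Z n : (0 : K) ^+ n.+1 = 0 by rewrite expr0n.
  have P (x y z p : K) : x = 0 -> y = 0 -> z = 0 -> qpochs_inf [:: x; y; z] p = 1.
    by move=> -> -> ->; rewrite qpochs_inf_zero //= eqxx.
  split; rewrite !P ?Z ?oppr0 // divr1 ?mul0r ?addr0; exact: has_sum3_zero.
(* From here on q is invertible. *)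
have q0' : 0 < `|q| by rewrite normr_gt0.
split.
- exact: (triple_has_sum geo comp q0' hq (limit_000_even q0 hq) (limit_000_odd q0 hq)).
- exact: (triple_has_sum geo comp q0' hq (limit_001_even q0 hq) (limit_001_odd q0 hq)).
- exact: (triple_has_sum geo comp q0' hq (limit_011_even q0 hq) (limit_011_odd q0 hq)).
- exact: (triple_has_sum geo comp q0' hq (limit_111_even q0 hq) (limit_111_odd q0 hq)).
Qed.

End FourIdentities.

Theorem theorem1p1 (R : realType) (q : R[i]) (hq : `|q| < 1) :
  [/\ has_sum3
        (fun i j k =>
           q ^+ (i ^ 2 + 2 * j ^ 2 + k ^ 2 + 2 * i * j + i * k)%N
           / (qpoch q q i * qpoch (q ^+ 2) (q ^+ 2) j
              * qpoch (q ^+ 2) (q ^+ 2) k))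
        (qpochs_inf [:: q ^+ 20; q ^+ 24; q ^+ 44] (q ^+ 44)
           / qpochs_inf [:: q; q ^+ 3; q ^+ 4] (q ^+ 4)
         + q * (qpochs_inf [:: - q; q ^+ 10; - q ^+ 11] (- q ^+ 11)
                / qpochs_inf [:: q ^+ 2; q ^+ 2; q ^+ 4] (q ^+ 4))),
      has_sum3
        (fun i j k =>
           q ^+ (i ^ 2 + 2 * j ^ 2 + k ^ 2 + 2 * i * j + i * k + k)%N
           / (qpoch q q i * qpoch (q ^+ 2) (q ^+ 2) j
              * qpoch (q ^+ 2) (q ^+ 2) k))
        (qpochs_inf [:: - q ^+ 5; q ^+ 6; - q ^+ 11] (- q ^+ 11)
           / qpochs_inf [:: q ^+ 2; q ^+ 2; q ^+ 4] (q ^+ 4)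
         + q * (qpochs_inf [:: q ^+ 12; q ^+ 32; q ^+ 44] (q ^+ 44)
                / qpochs_inf [:: q; q ^+ 3; q ^+ 4] (q ^+ 4))),
      has_sum3
        (fun i j k =>
           q ^+ (i ^ 2 + 2 * j ^ 2 + k ^ 2 + 2 * i * j + i * k + i + k)%N
           / (qpoch q q i * qpoch (q ^+ 2) (q ^+ 2) j
              * qpoch (q ^+ 2) (q ^+ 2) k))
        (qpochs_inf [:: q ^+ 4; - q ^+ 7; - q ^+ 11] (- q ^+ 11)
           / qpochs_inf [:: q ^+ 2; q ^+ 2; q ^+ 4] (q ^+ 4)
         + q ^+ 2 * (qpochs_inf [:: q ^+ 8; q ^+ 36; q ^+ 44] (q ^+ 44)
                     / qpochs_inf [:: q; q ^+ 3; q ^+ 4] (q ^+ 4)))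
    & has_sum3
        (fun i j k =>
           q ^+ (i ^ 2 + 2 * j ^ 2 + k ^ 2 + 2 * i * j + i * k
                 + 2 * i + 2 * j + k)%N
           / (qpoch q q i * qpoch (q ^+ 2) (q ^+ 2) j
              * qpoch (q ^+ 2) (q ^+ 2) k))
        (qpochs_inf [:: q ^+ 2; - q ^+ 9; - q ^+ 11] (- q ^+ 11)
           / qpochs_inf [:: q ^+ 2; q ^+ 2; q ^+ 4] (q ^+ 4)
         + q ^+ 3 * (qpochs_inf [:: q ^+ 4; q ^+ 40; q ^+ 44] (q ^+ 44)
                     / qpochs_inf [:: q; q ^+ 3; q ^+ 4] (q ^+ 4)))].
Proof.
have [H1 H2 H3 H4] := four_identities (@geometric_null_complex R)
  (@geometric_complete_complex R) hq.
split.
- apply: eq_has_sum3 H1 => // i j k; apply: (f_equal (fun n => q ^+ n / _)).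
  by rewrite /expo -!mulnn; lia.
- apply: eq_has_sum3 H2 => // i j k; apply: (f_equal (fun n => q ^+ n / _)).
  by rewrite /expo -!mulnn; lia.
- apply: eq_has_sum3 H3 => // i j k; apply: (f_equal (fun n => q ^+ n / _)).
  by rewrite /expo -!mulnn; lia.
- apply: eq_has_sum3 H4 => // i j k; apply: (f_equal (fun n => q ^+ n / _)).
  by rewrite /expo -!mulnn; lia.
Qed.
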